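(* If $P$ satisfies SYM and BAL, then $d_{\mathrm{cond}}\leq d_{\mathrm{KS}}$.
   Context: Let $\Omega$ be a finite set, $q=|\Omega|$, $k\geq2$. A weight function is a map $\psi:\Omega^k\to(0,2)$ (regarded as a point of $\mathbb R^{\Omega^k}$); $\psi^\theta(\sigma_1,\ldots,\sigma_k)=\psi(\sigma_{\theta(1)},\ldots,\sigma_{\theta(k)})$ for permutations $\theta$ of $[k]$. $\Psi$ is a measurable set of weight functions closed under all $\psi\mapsto\psi^\theta$, $P$ a probability distribution on $\Psi$, $\boldsymbol\psi$ a sample from $P$, $\xi=q^{-k}\sum_{\sigma\in\Omega^k}\mathbb E[\boldsymbol\psi(\sigma)]$. Standing assumption: $\mathbb E[\ln^8(1-\max_{\tau}|1-\boldsymbol\psi(\tau)|)]<\infty$, $\mathbb E[\max_{\tau}\boldsymbol\psi(\tau)^{-4}]<\infty$, $\sum_{\tau}\mathbb E[(\boldsymbol\psi(\tau)-\xi)^2]>0$. SYM: for all $i\in[k]$, $\omega\in\Omega$, $\psi\in\Psi$, $\sum_{\tau\in\Omega^k}\mathbf 1\{\tau_i=\omega\}\psi(\tau)=q^{k-1}\xi$, and $P(\mathcal A)=P(\{\psi^\theta:\psi\in\mathcal A\})$ for all $\theta$ and measurable $\mathcal A$. BAL: $\mu\in\mathcal P(\Omega)\mapsto\sum_{\tau}\mathbb E[\boldsymbol\psi(\tau)]\prod_{i}\mu(\tau_i)$ is concave and maximal at the uniform distribution ($\mathcal P(\Omega)$: probability distributions on $\Omega$). Bethe functional and condensation threshold: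 $\Lambda(x)=x\ln x$; $\mathcal P^2_*(\Omega)$ is the set of probability measures on $\mathcal P(\Omega)$ with mean the uniform distribution; with $\vec\gamma\sim\mathrm{Po}(d)$, $\vec\rho_j^\pi$ samples from $\pi$, $\boldsymbol\psi_i$ samples from $P$, all independent, $\mathcal B(d,P,\pi)=\mathbb E\big[\frac{1}{q\xi^{\vec\gamma}}\Lambda\big(\sum_{\sigma\in\Omega}\prod_{i=1}^{\vec\gamma}\sum_{\tau\in\Omega^k}\mathbf 1\{\tau_k=\sigma\}\boldsymbol\psi_i(\tau)\prod_{j=1}^{k-1}\vec\rho_{ki+j}^\pi(\tau_j)\big)-\frac{d(k-1)}{k\xi}\Lambda\big(\sum_{\tau}\boldsymbol\psi_1(\tau)\prod_{j=1}^k\vec\rho^\pi_j(\tau_j)\big)\big]$ and $d_{\mathrm{cond}}=\inf\{d>0:\sup_{\pi\in\mathcal P^2_*(\Omega)}\mathcal B(d,P,\pi)>\ln q+\frac dk\ln\xi\}$. Kesten–Stigum bound: for $\psi\in\Psi$ let $\Phi_\psi\in\mathbb R^{\Omega\times\Omega}$, $\Phi_\psi(\omega,\omega')=q^{1-k}\xi^{-1}\sum_{\tau\in\Omega^k}\mathbf 1\{\tau_1=\omega,\tau_2=\omega'\}\psi(\tau)$; let $\Xi=\mathbb E[\Phi_{\boldsymbol\psi}\otimes\Phi_{\boldsymbol\psi}]$ acting on $\mathbb R^\Omega\otimes\mathbb R^\Omega$; let $\mathcal E=\{z\in\mathbb R^\Omega\otimes\mathbb R^\Omega:\forall y\in\mathbb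 R^\Omega:\langle z,\mathbf 1\otimes y\rangle=\langle z,y\otimes\mathbf 1\rangle=0\}$ with $\mathbf 1$ the all-ones vector; and $d_{\mathrm{KS}}=\big((k-1)\max_{x\in\mathcal E:\|x\|=1}\langle\Xi x,x\rangle\big)^{-1}$, with $d_{\mathrm{KS}}=\infty$ if this maximum equals $0$. *)

(* Defs.v *)
From HB Require Import structures.
From mathcomp Require Import all_boot all_order all_algebra all_fingroup.
From mathcomp Require Import all_classical all_reals all_analysis.

Set Implicit Arguments.
Unset Strict Implicit.
Unset Printing Implicit Defensive.

Import Order.TTheory GRing.Theory Num.Theory.
Import numFieldNormedType.Exports.

Local Open Scope classical_set_scope.
Local Open Scope ring_scope.

(* R^I with the product sigma-algebra, which is the Borel sigma-algebra of the
   Euclidean space R^I when I is finite. *)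
Definition coord_preimages (R : realType) (I : Type) : set (set (I -> R)) :=
  \bigcup_i preimage_set_system setT (fun f : I -> R => f i) measurable.

Definition euclidean (R : realType) (I : Type) :=
  g_sigma_algebraType (@coord_preimages R I).

Section iid.
Context {d : measure_display} {T : measurableType d} {R : realType}.

Definition tcons n (x : T * n.-tuple T) : n.+1.-tuple T := [tuple of x.1 :: x.2].

Lemma measurable_tcons n : measurable_fun setT (@tcons n).
Proof. by apply: measurable_cons. Qed.

HB.instance Definition _ n :=
  isMeasurableFun.Build _ _ _ _ (@tcons n) (@measurable_tcons n).

(* The law of n independent samples of P. *)
Fixpoint iid (P : probability T R) n : probability (n.-tuple T) R :=
  match n with
  | 0 => \d_([tuple] : 0.-tuple T)
  | m.+1 => distribution (P \x iid P m)%E (@tcons m)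
  end.

End iid.

Section indices.
Context {k : nat} (hk : (2 <= k)%N).

Lemma pred_k_lt : (k.-1 < k)%N.
Proof. by rewrite ltn_predL ltnW. Qed.

Definition ord_first : 'I_k := Ordinal (ltnW hk).
Definition ord_second : 'I_k := Ordinal hk.
Definition ord_last : 'I_k := Ordinal pred_k_lt.

End indices.

Section model.
Context {R : realType} {Omega : finType} {k : nat}.

Local Notation q := (#|Omega|%:R : R).
Local Notation config := {ffun 'I_k -> Omega}.
Local Notation weight := (euclidean R config).

Definition is_weight (psi : weight) : Prop := forall tau, 0 < psi tau < 2.

Definition permute_weight (theta : 'S_k) (psi : weight) : weight :=
  fun sigma => psi [ffun i => sigma (theta i)].

Definition permutation_closed (Psi : set weight) : Prop :=
  forall theta psi, Psi psi -> Psi (permute_weight theta psi).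

Definition xi (P : probability weight R) : R :=
  q ^- k * \sum_(sigma : config) \int[P]_psi psi sigma.

(* Both maxima range over non-negative quantities, so their default value 0 is
   harmless. *)
Definition standing_assumption (P : probability weight R) : Prop :=
  [/\ (\int[P]_psi
          (ln (1 - \big[Num.max/0]_(tau : config) `|1 - psi tau|) ^+ 8)%:E
        < +oo)%E,
      (\int[P]_psi (\big[Num.max/0]_(tau : config) psi tau ^- 4)%:E < +oo)%E
    & 0 < \sum_(tau : config) \int[P]_psi (psi tau - xi P) ^+ 2].

Definition SYM (Psi : set weight) (P : probability weight R) : Prop :=
  (forall (i : 'I_k) (omega : Omega) (psi : weight), Psi psi ->
     \sum_(tau : config | tau i == omega) psi tau = q ^+ k.-1 * xi P) /\
  (forall (theta : 'S_k) (A : set weight), measurable A -> A `<=` Psi ->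
     P A = P (permute_weight theta @` A)).

Definition simplex : set (euclidean R Omega) :=
  [set mu | (forall omega, 0 <= mu omega) /\ \sum_omega mu omega = 1].

Definition uniform : euclidean R Omega := fun=> q^-1.

Definition mean_weight (P : probability weight R) (mu : euclidean R Omega) : R :=
  \sum_(tau : config) (\int[P]_psi psi tau) * \prod_(i < k) mu (tau i).

Definition BAL (P : probability weight R) : Prop :=
  (forall (mu nu : euclidean R Omega) (t : R),
     simplex mu -> simplex nu -> 0 <= t <= 1 ->
     t * mean_weight P mu + (1 - t) * mean_weight P nu <=
     mean_weight P (fun omega => t * mu omega + (1 - t) * nu omega)) /\
  (forall mu, simplex mu -> mean_weight P mu <= mean_weight P uniform).

(* A probability measure on the simplex is represented as a probability measure
   on R^Omega that is carried by the simplex. *)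
Definition P2star : set (probability (euclidean R Omega) R) :=
  [set pi : probability (euclidean R Omega) R | pi simplex = 1%E /\
            forall omega, \int[pi]_mu mu omega = uniform omega].

Definition Lambda (x : R) : R := x * ln x.

(* Samples are numbered from 0: psi_i is psis`_(i - 1) and rho_j is
   rhos`_(j - 1), so that rho_(k i + j) sits at position k i + (j - 1). *)
Definition bethe_integrand (hk : (2 <= k)%N) (P : probability weight R) (d : R)
    (g : nat) (psis : seq weight) (rhos : seq (euclidean R Omega)) : R :=
  let psi i := nth (fun=> 0) psis i in
  let rho j := nth (fun=> 0) rhos j in
  (q * xi P ^+ g)^-1 *
    Lambda (\sum_(sigma : Omega) \prod_(i < g)
      \sum_(tau : config | tau (ord_last hk) == sigma)
        psi i tau *
        \prod_(j < k | j != ord_last hk) rho (k * i.+1 + j)%N (tau j)) -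
  d * (k%:R - 1) / (k%:R * xi P) *
    Lambda (\sum_(tau : config) psi 0%N tau * \prod_(j < k) rho j (tau j)).

(* Expectation over gamma ~ Po(d) of the conditional expectation given gamma = g;
   at most psi_1, ..., psi_(g + 1) and rho_1, ..., rho_(k (g + 1)) occur in it.
   The second argument of poisson_prob is unused. *)
Definition bethe (hk : (2 <= k)%N) (d : R) (P : probability weight R)
    (pi : probability (euclidean R Omega) R) : \bar R :=
  (\int[poisson_prob d 0]_g
     \int[iid P g.+1 \x iid pi (k * g.+1)]_w
       (bethe_integrand hk P d g w.1 w.2)%:E)%E.

Definition dcond (hk : (2 <= k)%N) (P : probability weight R) : \bar R :=
  ereal_inf [set d%:E | d in [set d : R | 0 < d /\
    ((ln q + d / k%:R * ln (xi P))%:E <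
     ereal_sup [set bethe hk d P pi | pi in P2star])%E]].

Definition Phi (hk : (2 <= k)%N) (P : probability weight R) (psi : weight)
    (omega omega' : Omega) : R :=
  q ^- k.-1 * (xi P)^-1 *
  \sum_(tau : config | (tau (ord_first hk) == omega) &&
                       (tau (ord_second hk) == omega')) psi tau.

(* R^Omega (x) R^Omega is R^(Omega * Omega); matrices indexed by a finite type
   are two-argument functions. *)
Definition tensor_mx (A B : Omega -> Omega -> R) (u v : Omega * Omega) : R :=
  A u.1 v.1 * B u.2 v.2.

Definition tensor_vec (x y : Omega -> R) (u : Omega * Omega) : R :=
  x u.1 * y u.2.

Definition inner (x y : Omega * Omega -> R) : R := \sum_u x u * y u.

Definition norm2 (x : Omega * Omega -> R) : R := Num.sqrt (inner x x).

Definition Xi (hk : (2 <= k)%N) (P : probability weight R)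
    (u v : Omega * Omega) : R :=
  \int[P]_psi tensor_mx (Phi hk P psi) (Phi hk P psi) u v.

Definition Xi_op (hk : (2 <= k)%N) (P : probability weight R)
    (x : Omega * Omega -> R) (u : Omega * Omega) : R :=
  \sum_v Xi hk P u v * x v.

Definition Espace : set (Omega * Omega -> R) :=
  [set z | forall y : Omega -> R,
     inner z (tensor_vec (fun=> 1) y) = 0 /\
     inner z (tensor_vec y (fun=> 1)) = 0].

(* The supremum is a maximum, by compactness of the unit sphere of Espace. *)
Definition KS_max (hk : (2 <= k)%N) (P : probability weight R) : R :=
  sup [set inner (Xi_op hk P x) x | x in Espace `&` [set x | norm2 x = 1]].

Definition dKS (hk : (2 <= k)%N) (P : probability weight R) : \bar R :=
  if KS_max hk P == 0 then +oo%E
  else (((k%:R - 1) * KS_max hk P)^-1)%:E.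

End model.

(* Main.v *)
From HB Require Import structures.
Require Import Defs.
From mathcomp Require Import all_boot all_order all_algebra all_fingroup.
From mathcomp Require Import all_classical all_reals all_analysis.
From mathcomp Require Import measurable_realfun spectral ring lra.
From mathcomp.real_closed Require Import complex.

(* Above the Kesten-Stigum bound the trivial solution (all mass at the uniform
   distribution) is unstable: a small perturbation of it already beats
   ln q + (d/k) ln xi.  Let pi be the law of (1 + z)/q with z centered, summing to
   zero, of size e and with covariance S.  By SYM both arguments of Lambda, suitably
   normalized, have the form 1 + s with s = s_2 + O(e^3), where s_2 is a quadratic
   form in independent copies of z without diagonal terms, and E s = 0; hence
   E Lambda(1 + s) = E[s_2^2]/2 + O(e^5).  Summing the contributions over the Poisson
   degree gives
     B(d, P, pi) - ln q - (d/k) ln xi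
       = (d (k-1) / (4 q^2)) (d (k-1) |Xi S|^2 - <S, Xi S>) + O(e^5).
   For degrees beyond a cutoff only x ln x >= x - 1 is used, so that e may be chosen
   after the cutoff.  It remains to find a covariance S, that is, a positive
   semidefinite S in the space E, with d (k-1) |Xi S|^2 > <S, Xi S>.  A matrix X in E
   with |X| = 1 and d (k-1) <X, Xi X> > 1 factors as X = U V^T with
   |U U^T| = |V V^T| = |X|, and since Xi is the average of Phi (x) Phi, one of
   S = U U^T, V V^T satisfies <S, Xi S> >= <X, Xi X>; conclude by Cauchy-Schwarz. *)

Set Implicit Arguments.
Unset Strict Implicit.
Unset Printing Implicit Defensive.

Import Order.TTheory GRing.Theory Num.Theory.
Import numFieldNormedType.Exports.

Local Open Scope classical_set_scope.
Local Open Scope ring_scope.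

(** * Second-order expansions *)

(** The expansion is decided by pairs of distinct leaves. Two leaves of one clause contribute <S, Xi
    S>; two leaves of different clauses interact through the root and contribute |Xi S|^2. Their
    numbers g(k-1)(k-2) and g(g-1)(k-1)^2 have Poisson means d(k-1)(k-2) and d^2(k-1)^2, while the
    edge term subtracts d(k-1)/k times k(k-1). As d(k-1)(k-2) - d(k-1)^2 = -d(k-1), this yields the
    stated bracket. At order zero, g ln xi averages to d ln xi, and the edge term leaves (d/k) ln
    xi. The cutoff is forced because the error constant of the expansion grows with g. Discarding
    the second moments beyond it only lowers the bound, since they are non-negative. The
    factorization is forced because a near-maximizer X need not be positive semidefinite, whereas a
    covariance must be. Equality of the norms keeps S on the unit sphere, where |Xi S| >= <S, Xi S>,
    whence d(k-1)|Xi S|^2 >= d(k-1)<S, Xi S>^2 > <S, Xi S>. *)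

Section jets.
Context {R : realType}.
Implicit Types (e C Y a b : R).

(** An expansion 1 + a + b + O(e^3) with [a] of first and [b] of second order. A single constant
    serves all three bounds, so that products and means track only one number. *)
Definition jet e C Y a b :=
  [/\ `|a| <= C * e, `|b| <= C * e ^+ 2 & `|Y - 1 - a - b| <= C * e ^+ 3].

Lemma jet_le e C C' Y a b : 0 <= e -> C <= C' -> jet e C Y a b -> jet e C' Y a b.
Proof.
move=> e0 CC' [ha hb hY]; split; first exact: le_trans ha (ler_wpM2r _ CC').
- by apply: le_trans hb (ler_wpM2r _ CC'); rewrite exprn_ge0.
- by apply: le_trans hY (ler_wpM2r _ CC'); rewrite exprn_ge0.
Qed.

(** Of the 8 in the constant, 3 come from the products of [a], [b] with [a'], [b'] of order at least
    three, and 5 from the remainders multiplied by the other factor. *)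
Lemma jet_mul e C C' Y Y' a a' b b' : 0 <= e <= 1 -> 0 <= C -> 0 <= C' ->
  jet e C Y a b -> jet e C' Y' a' b' ->
  jet e (C + C' + 8 * C * C') (Y * Y') (a + a') (b + b' + a * a').
Proof.
move=> /andP[e0 e1] C0 C'0 [ha hb hY] [ha' hb' hY'].
have e2 : 0 <= e ^+ 2 by rewrite exprn_ge0.
have e3 : 0 <= e ^+ 3 by rewrite exprn_ge0.
have CC' : 0 <= C * C' by rewrite mulr_ge0.
have le1 n : e ^+ n <= 1 by rewrite exprn_ile1.
have bound1 c n : 0 <= c -> c * e ^+ n <= c by move=> c0; rewrite ler_piMr.
have prod_le x y u v n m : `|x| <= u * e ^+ n -> `|y| <= v * e ^+ m ->
    `|x * y| <= u * v * e ^+ (n + m).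
  by move=> hx hy; rewrite normrM exprD mulrACA ler_pM.
have haa' : `|a * a'| <= C * C' * e ^+ 2 by apply: (prod_le _ _ _ _ 1%N 1%N).
split.
- apply: le_trans (ler_normD _ _) _; apply: le_trans (lerD ha ha') _.
  by rewrite -mulrDl ler_wpM2r// lerDl; lra.
- apply: le_trans (ler_normD _ _) _.
  apply: le_trans (lerD (ler_normD _ _) haa') _.
  apply: le_trans (lerD (lerD hb hb') (lexx _)) _.
  by rewrite -!mulrDl ler_wpM2r// lerD2l; lra.
- pose r := Y - 1 - a - b; pose r' := Y' - 1 - a' - b'.
  have -> : Y * Y' - 1 - (a + a') - (b + b' + a * a') =
      a * b' + b * a' + b * b' + r * Y' + (1 + a + b) * r'.
    by rewrite /r /r'; ring.
  have h1 : `|a * b'| <= C * C' * e ^+ 3 by apply: (prod_le _ _ _ _ 1%N 2%N).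
  have h2 : `|b * a'| <= C * C' * e ^+ 3 by apply: (prod_le _ _ _ _ 2%N 1%N).
  have h3 : `|b * b'| <= C * C' * e ^+ 3.
    apply: le_trans (prod_le _ _ _ _ 2%N 2%N hb hb') _.
    by rewrite ler_wpM2l// (exprD _ 3 1) ler_piMr.
  have hYb : `|Y'| <= 1 + 3 * C'.
    have -> : Y' = 1 + a' + b' + r' by rewrite /r'; ring.
    apply: le_trans (ler_normD _ _) _; apply: le_trans (lerD (ler_normD _ _) hY') _.
    have := ler_normD 1 a'; rewrite normr1.
    have := bound1 C' 1%N C'0; have := bound1 C' 2%N C'0.
    by have := bound1 C' 3%N C'0; lra.
  have hab : `|1 + a + b| <= 1 + 2 * C.
    apply: le_trans (ler_normD _ _) _.
    have := ler_normD 1 a; rewrite normr1.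
    by have := bound1 C 1%N C0; have := bound1 C 2%N C0; lra.
  have h4 : `|r * Y'| <= C * (1 + 3 * C') * e ^+ 3.
    by rewrite normrM mulrAC ler_pM.
  have h5 : `|(1 + a + b) * r'| <= (1 + 2 * C) * C' * e ^+ 3.
    by rewrite normrM -mulrA ler_pM.
  have -> : (C + C' + 8 * C * C') * e ^+ 3 = C * C' * e ^+ 3 + C * C' * e ^+ 3 +
     C * C' * e ^+ 3 + C * (1 + 3 * C') * e ^+ 3 + (1 + 2 * C) * C' * e ^+ 3 by ring.
  do 4 (apply: le_trans (ler_normD _ _) _; apply: lerD => //).
Qed.

Fixpoint jet_const C n : R :=
  if n is m.+1 then C + jet_const C m + 8 * C * jet_const C m else 0.

Lemma jet_const_ge0 C n : 0 <= C -> 0 <= jet_const C n.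
Proof. by move=> C0; elim: n => //= n IH; rewrite !addr_ge0// !mulr_ge0. Qed.

(** Iterating [jet_mul] accumulates the second elementary symmetric polynomial of the [a i], written
    here through power sums. It contains no squares, which is why the quadratic forms below have no
    diagonal. *)
Lemma jet_prod e C (I : Type) (r : seq I) (P : pred I) (Y a b : I -> R) :
  0 <= e <= 1 -> 0 <= C -> (forall i, P i -> jet e C (Y i) (a i) (b i)) ->
  jet e (jet_const C (size r)) (\prod_(i <- r | P i) Y i)
    (\sum_(i <- r | P i) a i)
    (\sum_(i <- r | P i) b i +
     2^-1 * ((\sum_(i <- r | P i) a i) ^+ 2 - \sum_(i <- r | P i) a i ^+ 2)).
Proof.
move=> e01 C0 H; have /andP[e0 _] := e01; elim: r => [|i r IH] /=.
  rewrite !big_nil /jet !mul0r; split;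
    by rewrite ?expr0n ?subrr ?mulr0 ?addr0 ?subr0 ?subrr normr0.
rewrite !big_cons; case: ifPn => Pi; last first.
  apply: jet_le IH => //; have := jet_const_ge0 (size r) C0.
  by move=> h; rewrite addrAC lerDr addr_ge0// !mulr_ge0.
have := jet_mul e01 C0 (jet_const_ge0 (size r) C0) (H _ Pi) IH.
set s := \sum_(j <- r | _) _; set t := \sum_(j <- r | _) _.
set v := \sum_(j <- r | _) _.
by congr jet; field.
Qed.

(** The three bounds are convex conditions, hence survive averaging with the same constant. *)
Lemma jet_mean e C (I : finType) (P : pred I) (p Y a b : I -> R) : 0 <= e -> 0 <= C ->
  (forall i, P i -> 0 <= p i) -> \sum_(i | P i) p i = 1 ->
  (forall i, P i -> jet e C (Y i) (a i) (b i)) ->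
  jet e C (\sum_(i | P i) p i * Y i) (\sum_(i | P i) p i * a i)
    (\sum_(i | P i) p i * b i).
Proof.
move=> e0 C0 p0 p1 H.
have mean (f : I -> R) c : (forall i, P i -> `|f i| <= c) ->
    `|\sum_(i | P i) p i * f i| <= c.
  move=> hf; apply: le_trans (ler_norm_sum _ _ _) _.
  rewrite -[leRHS]mul1r -p1 mulr_suml; apply: ler_sum => i Pi.
  by rewrite normrM ger0_norm ?p0// ler_wpM2l ?p0 ?hf.
split; [apply: mean => i /H[]//..|].
rewrite -p1 -!sumrB (eq_bigr (fun i => p i * (Y i - 1 - a i - b i))).
  by apply: mean => i /H[].
by move=> i _; ring.
Qed.

Lemma jet_1D e z : 0 <= e -> `|z| <= e -> jet e 1 (1 + z) z 0.
Proof.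
move=> e0 hz; split.
- by rewrite mul1r.
- by rewrite normr0 mul1r exprn_ge0.
- have -> : 1 + z - 1 - z - 0 = 0 by ring.
  by rewrite normr0 mul1r exprn_ge0.
Qed.

End jets.

(** * Taylor bounds for x ln x near 1 *)

Section entropy_bounds.
Context {R : realType}.
Implicit Types x : R.

Lemma Lambda_tangent x : 0 < x -> x - 1 <= x * ln x.
Proof.
move=> x0; have h : ln x^-1 <= x^-1 - 1.
  have := @le_ln1Dx R (x^-1 - 1); rewrite (addrC 1) subrK; apply.
  by rewrite -subr_gt0 opprK subrK invr_gt0.
have : x * ln x^-1 <= x * (x^-1 - 1) by rewrite ler_wpM2l// ltW.
rewrite lnV ?posrE// mulrBr divff ?gt_eqF//; lra.
Qed.

(** The error vanishes at 0 and has derivative y^2 / (1 + y), at most 2 y^2 on [-1/2, 1/2]; the mean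
    value theorem is applied on either side of 0. *)
Lemma ln1D_taylor2 x : `|x| <= 2^-1 ->
  `|ln (1 + x) - x + x ^+ 2 / 2| <= 2 * `|x| ^+ 3.
Proof.
move=> hx; pose h := fun y : R => ln (1 + y) - y + 2^-1 * y ^+ 2.
have dh (y : R) : `|y| <= 2^-1 -> is_derive y 1 h (y ^+ 2 / (1 + y)).
  move=> /ler_normlP[y1 y2]; have y0 : 0 < 1 + y by lra.
  have dl : is_derive y 1 (fun t : R => ln (1 + t)) ((1 + y)^-1).
    have := @is_derive1_comp _ (@ln R) (fun t => 1 + t) y (1 + y)^-1 1
      (is_derive1_ln y0); rewrite mulr1; apply.
    apply: is_derive_eq.
    by ring.
  apply: is_derive_eq.
  rewrite /GRing.scale /= !mulr1 ?expr1.
  have yn0 : 1 + y != 0 by rewrite gt_eqF.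
  by field.
have ch : forall t : R, `|t| <= 2^-1 -> {for t, continuous h}.
  by move=> t hy; apply: differentiable_continuous; apply/derivable1_diffP;
     have [] := dh _ hy.
have h0 : h 0 = 0 by rewrite /h addr0 ln1; ring.
have key c : `|c| <= `|x| -> `|c ^+ 2 / (1 + c) * x| <= 2 * `|x| ^+ 3.
  move=> cx; have c2 : 2^-1 <= 1 + c.
    by have := le_trans cx hx; move=> /ler_normlP[]; lra.
  have c0 : 0 < 1 + c by apply: lt_le_trans c2.
  rewrite 2!normrM normfV (ger0_norm (ltW c0)) normrX [X in 2 * X]exprSr mulrA.
  rewrite ler_wpM2r// ler_pdivrMr// mulrAC.
  have : `|c| ^+ 2 <= `|x| ^+ 2 by rewrite lerXn2r// nnegrE.
  move/le_trans; apply; rewrite ler_peMl ?exprn_ge0//; lra.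
have -> : ln (1 + x) - x + x ^+ 2 / 2 = h x by rewrite /h; ring.
have [x0|x0] := leP 0 x.
  have [||c] := @MVT_segment _ h (fun y => y ^+ 2 / (1 + y)) 0 x x0.
  - move=> y; rewrite in_itv/= => /andP[y0 yx]; apply: dh.
    by rewrite ger0_norm ?ltW//; move: hx; rewrite ger0_norm//; lra.
  - apply: continuous_in_subspaceT => y; rewrite inE/= in_itv/= => /andP[y0 yx].
    by apply: ch; rewrite ger0_norm//; move: hx; rewrite ger0_norm//; lra.
  - rewrite in_itv/= h0 !subr0 => /andP[c0 cx] ->; apply: key.
    by rewrite !ger0_norm.
have x0' := ltW x0.
have [||c] := @MVT_segment _ h (fun y => y ^+ 2 / (1 + y)) x 0 x0'.
- move=> y; rewrite in_itv/= => /andP[y0 yx]; apply: dh.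
  by rewrite ler0_norm ?ltW//; move: hx; rewrite ler0_norm//; lra.
- apply: continuous_in_subspaceT => y; rewrite inE/= in_itv/= => /andP[y0 yx].
  by apply: ch; rewrite ler0_norm//; move: hx; rewrite ler0_norm//; lra.
- rewrite in_itv/= h0 sub0r => /andP[c0 cx] /eqP.
  rewrite sub0r mulrN eqr_opp => /eqP ->; apply: key.
  by rewrite !ler0_norm// lerN2.
Qed.

Lemma Lambda1D_taylor2 x : `|x| <= 2^-1 ->
  `|(1 + x) * ln (1 + x) - x - x ^+ 2 / 2| <= 4 * `|x| ^+ 3.
Proof.
move=> hx; have := ln1D_taylor2 hx.
set h := ln (1 + x) - x + x ^+ 2 / 2 => hh.
(* The constant 4 covers 3/2 times 2 from [h], plus 1/2 from the cubic term. *)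
have -> : (1 + x) * ln (1 + x) - x - x ^+ 2 / 2 = (1 + x) * h - 2^-1 * x ^+ 3.
  by rewrite /h; field.
apply: le_trans (ler_normB _ _) _.
rewrite [`|_ * h|]normrM [`|_ * x ^+ 3|]normrM normrX normfV (ger0_norm (ler0n R 2)).
have : `|1 + x| <= 3 / 2.
  by apply: le_trans (ler_normD _ _) _; rewrite normr1; lra.
move=> /ler_pM /(_ hh) /=; rewrite !normr_ge0 => /(_ isT isT).
have := exprn_ge0 3 (normr_ge0 x); lra.
Qed.

End entropy_bounds.

(** * Balanced factorization of a square matrix *)

Section polar.
Context {R : rcfType}.

(** Turns functions of [X *m X^T], such as fractional powers, into polynomials in it, which are
    symmetric and commute with one another. *)
Lemma poly_interpolation (F : fieldType) (f : F -> F) (l : seq F) :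
  exists p : {poly F}, forall x, x \in l -> p.[x] = f x.
Proof.
elim: l => [|x l [p Hp]]; first by exists 0.
have [xl|xl] := boolP (x \in l).
  by exists p => y; rewrite inE => /orP[/eqP->|/Hp//]; exact: Hp.
pose w := \prod_(y <- l) ('X - y%:P).
have wx0 : w.[x] != 0 by rewrite -[_ == _]/(root w x) root_prod_XsubC.
exists (p + ((f x - p.[x]) / w.[x])%:P * w) => y; rewrite inE => /orP[/eqP->|yl].
  by rewrite !hornerE divfK// addrC subrK.
have /rootP wy0 : root w y by rewrite root_prod_XsubC.
by rewrite !hornerE wy0 mulr0 addr0 Hp.
Qed.

Lemma trmx_horner_mx n (A : 'M[R]_n.+1) p : A^T = A -> (horner_mx A p)^T = horner_mx A p.
Proof.
move=> tA; elim/poly_ind: p => [|p c IH]; first by rewrite raddf0 trmx0.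
rewrite rmorphD rmorphM /= horner_mx_X horner_mx_C linearD/= tr_scalar_mx.
rewrite trmx_mul tA IH; congr (_ + _).
by rewrite -[LHS]/(A * _) -[RHS]/(_ * A); apply: comm_mx_horner.
Qed.

Lemma mulmx_trmx_eq0 m n (M : 'M[R]_(m, n)) : M *m M^T = 0 -> M = 0.
Proof.
move=> M0; apply/matrixP => i j; rewrite mxE.
have /matrixP/(_ i i) := M0; rewrite !mxE => /eqP.
rewrite psumr_eq0 => [/allP/(_ j (mem_index_enum _))|k _]; last first.
  by rewrite mxE -expr2 sqr_ge0.
by rewrite mxE /= mulf_eq0 orbb => /eqP.
Qed.

(** Serves as a spectral theorem: an identity between polynomials in [X *m X^T] has only to be
    checked at the values [l i]. Over [R[i]] the matrix is hermitian, hence unitarily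
    diagonalizable; the conclusion descends to [R] by injectivity of the inclusion. *)
Lemma mulmx_trmx_spectrum n (X : 'M[R]_n.+1) :
  exists2 l : 'I_n.+1 -> R, (forall i, 0 <= l i) &
    forall p, (forall i, p.[l i] = 0) -> horner_mx (X *m X^T) p = 0.
Proof.
pose f := real_complex R; pose X' : 'M[R[i]]_n.+1 := map_mx f X.
pose A' := X' *m X'^T.
have X'r : map_mx Num.conj X' = X'.
  by apply/matrixP => i j; rewrite !mxE; apply/CrealP/complex_realP; exists (X i j).
have Ah : A' \is hermsymmx.
  apply/is_hermitianmxP; rewrite expr0 scale1r /A' trmx_mul trmxK.
  by rewrite map_mxM -map_trmx X'r.
have /orthomx_spectralP A'E := hermitian_normalmx Ah.
set P := spectralmx A' in A'E; set D := spectral_diag A' in A'E.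
have Pu : P \in unitmx by exact: spectral_unit.
have D0 i : 0 <= D 0 i.
  (* Each diagonal entry of [D] is the squared norm of a row of [P *m X']. *)
  have DE : diag_mx D = (P *m X') *m (map_mx Num.conj (P *m X')^T).
    rewrite trmx_mul map_mxM -map_trmx X'r mulmxA -(mulmxA P) -/A' A'E.
    rewrite -invmx_unitary ?spectral_unitarymx// -/P.
    by rewrite !mulmxA mulmxV// mul1mx mulmxK.
  have /matrixP/(_ i i) := DE; rewrite !mxE eqxx mulr1n => ->.
  by apply: sumr_ge0 => j _; rewrite !mxE mul_conjC_ge0.
have /all_sig[l lE] i : {x : R | D 0 i = f x}.
  apply: sig_eqW; have /complex_realP[x ->] : D 0 i \is Num.real by rewrite ger0_real.
  by exists x.
exists l => [i|p pl]; first by rewrite -ler0c; have := D0 i; rewrite lE.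
apply: (@map_mx_inj _ _ f); rewrite map_horner_mx map_mx0.
rewrite map_mxM -map_trmx -/X' -/A' A'E -[X in _ *m X]invmxK.
rewrite horner_mx_uconj ?unitmx_inv// horner_mx_diag.
suff -> : map_mx (horner (map_poly f p)) D = 0 by rewrite linear0 mulmx0 mul0mx.
by apply/matrixP => i j; rewrite !mxE ord1 lE horner_map pl rmorph0.
Qed.

(* The singular value decomposition X = sum_i s_i u_i v_i^T is balanced as
   U = (X X^T)^(1/4), V^T = (X X^T)^(-1/4) X; powers are polynomials in X X^T. *)
Lemma polar_factor n (X : 'M[R]_n.+1) : exists U V : 'M[R]_n.+1,
  [/\ X = U *m V^T,
      \tr (U *m U^T *m (U *m U^T)) = \tr (X *m X^T),
      \tr (V *m V^T *m (V *m V^T)) = \tr (X *m X^T),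
      forall v : 'rV_n.+1, v *m X = 0 -> v *m U = 0
    & forall v : 'cV_n.+1, X *m v = 0 -> V^T *m v = 0].
Proof.
have [l l0 HA] := mulmx_trmx_spectrum X; set A := X *m X^T in HA *.
have At : A^T = A by rewrite trmx_mul trmxK.
pose phi (x : R) := Num.sqrt (Num.sqrt x).
have [r Hr] := poly_interpolation phi (codom l).
(* At a zero eigenvalue the inverse is 0 by convention, so [W] below is a pseudo-inverse of [U]. *)
have [s Hs] := poly_interpolation (fun x => (phi x)^-1) (codom l).
have phi4 i : phi (l i) ^+ 4 = l i.
  by rewrite (exprM _ 2 2) !sqr_sqrtr ?sqrtr_ge0.
have rl i : r.[l i] = phi (l i) by apply: Hr; rewrite codom_f.
have sl i : s.[l i] = (phi (l i))^-1 by apply: Hs; rewrite codom_f.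
have polyE p p' : (forall i, p.[l i] = p'.[l i]) -> horner_mx A p = horner_mx A p'.
  move=> pp'; apply/eqP; rewrite -subr_eq0 -rmorphB; apply/eqP/HA => i.
  by rewrite !hornerE pp' subrr.
pose U := horner_mx A r; pose W := horner_mx A s.
have AX : horner_mx A 'X = A by rewrite horner_mx_X.
have mulE (B C : 'M[R]_n.+1) : B *m C = B * C by [].
have Ut : U^T = U by apply: trmx_horner_mx.
have Wt : W^T = W by apply: trmx_horner_mx.
have phi0 i : phi (l i) = 0 -> l i = 0 by rewrite -{2}phi4 => ->; rewrite expr0n.
(* The left factor [A = X *m X^T] makes every row vector annihilating [X] annihilate [U]. *)
have UA : U = A *m (W *m W *m W).
  rewrite !mulE -[in RHS]AX -!rmorphM /=; apply: polyE => i.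
  rewrite !(hornerM, hornerD, hornerN, hornerC, hornerX) rl sl.
  have [f0|f0] := eqVneq (phi (l i)) 0.
    by rewrite f0 (phi0 _ f0) mul0r.
  by have /esym := phi4 i; set t := phi (l i) in f0 * => ->; field.
(* [U *m W] projects onto the range of [A]. It fixes [X], because the difference [U *m W *m X - X]
   multiplied by its own transpose contains the vanishing factor [(U *m W - 1) *m A]. *)
have UWX : U *m W *m X = X.
  apply/eqP; rewrite -subr_eq0; apply/eqP/mulmx_trmx_eq0.
  rewrite -[X in _ - X]mul1mx -mulmxBl trmx_mul mulmxA -(mulmxA _ X) -/A.
  suff -> : (U *m W - 1%:M) *m A = 0 by rewrite mul0mx.
  rewrite !mulE -AX -!rmorphM -[1%:M](rmorph1 (horner_mx A)) -rmorphB -rmorphM.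
  apply: HA => i; rewrite !(hornerM, hornerD, hornerN, hornerC, hornerX) rl sl.
  have [/phi0->|f0] := eqVneq (phi (l i)) 0; first by rewrite mulr0.
  by rewrite divff// subrr mul0r.
exists U, (W *m X)^T; rewrite trmxK; split.
- by rewrite mulmxA UWX.
- rewrite Ut; congr (\tr _); rewrite !mulE -[RHS]AX -!rmorphM /=.
  apply: polyE => i; rewrite !hornerM hornerX rl.
  by have /esym := phi4 i; set t := phi (l i) => ->; ring.
(* Cyclicity of the trace turns the product into a polynomial in [A], whose value at a non-zero
   eigenvalue l is l^2 (l^(-1/4))^4 = l. *)
- rewrite -!mulmxA mxtrace_mulC; congr (\tr _).
  rewrite trmx_mul Wt !mulmxA -(mulmxA W X) -/A -(mulmxA (W *m A *m W *m W) X).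
  have -> : W *m A *m W *m W *m (X *m X^T) *m W =
      horner_mx A (s * 'X * s * s * 'X * s).
    by rewrite !rmorphM /= AX.
  rewrite -[RHS]AX; apply: polyE => i.
  rewrite !(hornerM, hornerD, hornerN, hornerC, hornerX) sl.
  have [/phi0->|f0] := eqVneq (phi (l i)) 0.
    by rewrite !(mulr0, mul0r).
  by have /esym := phi4 i; set t := phi (l i) in f0 * => ->; field.
- by move=> v vX; rewrite UA mulmxA /A mulmxA vX !mul0mx.
- by move=> v Xv; rewrite -mulmxA Xv mulmx0.
Qed.

End polar.

(** * Bounded random variables and independent samples *)

Section bounded.
Context {d : measure_display} {T : measurableType d} {R : realType}.
Variable mu : probability T R.
Implicit Types f g : T -> R.

(** What is integrated exactly is polynomial in the samples, and these are bounded only almost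
    surely, since [P] and [pi] live on whole Euclidean spaces. The class is closed under ring
    operations and consists of integrable functions. *)
Definition ae_bounded f :=
  measurable_fun setT f /\ exists M, {ae mu, forall x, `|f x| <= M}.

Lemma ae_bounded_measurable f : ae_bounded f -> measurable_fun setT f.
Proof. by case. Qed.

Lemma ae_bounded_cst r : ae_bounded (fun=> r).
Proof. by split=> //; exists `|r|; apply: aeW => x. Qed.

Lemma ae_boundedD f g : ae_bounded f -> ae_bounded g ->
  ae_bounded (fun x => f x + g x).
Proof.
move=> [mf [M hM]] [mg [N hN]]; split; first exact: measurable_funD.
exists (M + N); apply: filterS2 hM hN => x fM gN.
exact: le_trans (ler_normD _ _) (lerD fM gN).
Qed.

Lemma ae_boundedM f g : ae_bounded f -> ae_bounded g ->
  ae_bounded (fun x => f x * g x).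
Proof.
move=> [mf [M hM]] [mg [N hN]]; split; first exact: measurable_funM.
exists (M * N); apply: filterS2 hM hN => x fM gN.
by rewrite normrM ler_pM.
Qed.

Lemma ae_boundedZ r f : ae_bounded f -> ae_bounded (fun x => r * f x).
Proof. exact: ae_boundedM (ae_bounded_cst _). Qed.

Lemma ae_boundedX n f : ae_bounded f -> ae_bounded (fun x => f x ^+ n).
Proof.
move=> bf; elim: n => [|n IH]; first exact: ae_bounded_cst.
by under eq_fun do rewrite exprS; exact: ae_boundedM.
Qed.

Lemma ae_bounded_sum (I : Type) (r : seq I) (P : pred I) (f : I -> T -> R) :
  (forall i, P i -> ae_bounded (f i)) ->
  ae_bounded (fun x => \sum_(i <- r | P i) f i x).
Proof.
move=> bf; elim: r => [|i r IH].
  by under eq_fun do rewrite big_nil; exact: ae_bounded_cst.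
have [Pi|/negbTE Pi] := boolP (P i); last by under eq_fun do rewrite big_cons Pi.
under eq_fun do rewrite big_cons Pi.
by apply: ae_boundedD => //; exact: bf.
Qed.

Lemma ae_bounded_prod (I : Type) (r : seq I) (P : pred I) (f : I -> T -> R) :
  (forall i, P i -> ae_bounded (f i)) ->
  ae_bounded (fun x => \prod_(i <- r | P i) f i x).
Proof.
move=> bf; elim: r => [|i r IH].
  by under eq_fun do rewrite big_nil; exact: ae_bounded_cst.
have [Pi|/negbTE Pi] := boolP (P i); last by under eq_fun do rewrite big_cons Pi.
under eq_fun do rewrite big_cons Pi.
by apply: ae_boundedM => //; exact: bf.
Qed.

Lemma ae_bounded_integrable f : ae_bounded f -> mu.-integrable setT (EFin \o f).
Proof.
move=> [mf [M hM]]; apply/integrableP; split; first exact/measurable_EFinP.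
apply: (@le_lt_trans _ _ (\int[mu]_x (cst `|M|%:E x))%E); last first.
  by rewrite integral_cst// [X in (_ * X)%E]probability_setT mule1 ltry.
apply: ae_ge0_le_integral => //.
- by apply: measurableT_comp => //; exact/measurable_EFinP.
- by move=> x _; rewrite lee_fin.
- by apply: filterS hM => x fM _; rewrite /= lee_fin (le_trans fM)// ler_norm.
Qed.

Lemma RintegralD_bounded f g : ae_bounded f -> ae_bounded g ->
  \int[mu]_x (f x + g x) = \int[mu]_x f x + \int[mu]_x g x.
Proof. by move=> bf bg; apply: RintegralD => //; exact: ae_bounded_integrable. Qed.

Lemma RintegralZ_bounded r f : ae_bounded f ->
  \int[mu]_x (r * f x) = r * \int[mu]_x f x.
Proof. by move=> bf; apply: RintegralZl => //; exact: ae_bounded_integrable. Qed.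

Lemma Rintegral_cst1 r : \int[mu]_x r = r.
Proof. by rewrite Rintegral_cst// [X in fine X]probability_setT mulr1. Qed.

Lemma Rintegral_sum (I : Type) (r : seq I) (P : pred I) (f : I -> T -> R) :
  (forall i, P i -> ae_bounded (f i)) ->
  \int[mu]_x (\sum_(i <- r | P i) f i x) = \sum_(i <- r | P i) \int[mu]_x f i x.
Proof.
move=> bf; elim: r => [|i r IH].
  by under eq_Rintegral do rewrite big_nil; rewrite big_nil Rintegral_cst1.
rewrite big_cons; have [Pi|/negbTE Pi] := boolP (P i); last first.
  by under eq_Rintegral do rewrite big_cons Pi.
under eq_Rintegral do rewrite big_cons Pi.
by rewrite RintegralD_bounded ?IH//; [exact: bf|exact: ae_bounded_sum].
Qed.

(** Positive and negative parts are compared separately, without integrability; thus the Bethe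
    integrand, known only to be measurable, can be bounded from below. *)
Lemma le_integral_ae (f g : T -> \bar R) : measurable_fun setT f ->
  measurable_fun setT g -> {ae mu, forall x, (f x <= g x)%E} ->
  (\int[mu]_x f x <= \int[mu]_x g x)%E.
Proof.
move=> mf mg fg; rewrite [leLHS]integralE [leRHS]integralE; apply: leeB.
- apply: ae_ge0_le_integral => //; [exact: measurable_funepos..|].
  by apply: filterS fg => x h _; rewrite !funeposE ge_max le_max h /= le_max lexx orbT.
- apply: ae_ge0_le_integral => //; [exact: measurable_funeneg..|].
  by apply: filterS fg => x h _; rewrite !funenegE ge_max !le_max leeN2 h lexx orbT.
Qed.

Lemma Rintegral_le_integral f g : ae_bounded f -> measurable_fun setT g ->
  {ae mu, forall x, f x <= g x} -> ((\int[mu]_x f x)%:E <= \int[mu]_x (g x)%:E)%E.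
Proof.
move=> bf mg fg; rewrite /Rintegral fineK; last first.
  by apply: integrable_fin_num => //; exact: ae_bounded_integrable.
apply: le_integral_ae; first exact/measurable_EFinP/ae_bounded_measurable.
  exact/measurable_EFinP.
by apply: filterS fg => x h; rewrite lee_fin.
Qed.

End bounded.

Section laws.
Context {d d' : measure_display} {T : measurableType d} {T' : measurableType d'}.
Context {R : realType} (mu : probability T R) (nu : probability T' R).

Definition has_law (X : T -> T') := measurable_fun setT X /\
  forall A, measurable A -> mu (X @^-1` A) = nu A.

Variables (X : T -> T') (lX : has_law X).

Lemma ae_law (Q : T' -> Prop) : {ae nu, forall y, Q y} ->
  {ae mu, forall x, Q (X x)}.
Proof.
case: lX => mX hX [N [mN N0 hN]]; exists (X @^-1` N); split.
- by rewrite -[_ @^-1` _]setTI; exact: mX.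
- by rewrite hX.
- by move=> x /= hx; apply: hN.
Qed.

Lemma ae_bounded_law f : ae_bounded nu f -> ae_bounded mu (f \o X).
Proof.
move=> [mf [M hM]]; split; first by case: lX => mX _; exact: measurableT_comp.
by exists M; exact: (ae_law hM).
Qed.

Lemma Rintegral_law f : ae_bounded nu f ->
  \int[mu]_x f (X x) = \int[nu]_y f y.
Proof.
move=> bf; case: (lX) => mX hX; congr fine.
pose Xm : {mfun T >-> T'} := HB.pack X (isMeasurableFun.Build _ _ _ _ X mX).
rewrite [RHS](eq_measure_integral (distribution mu Xm)); last first.
  by move=> A mA _; exact: (esym (hX A mA)).
rewrite integral_distribution//.
  exact/measurable_EFinP/(ae_bounded_measurable bf).
exact: (ae_bounded_integrable (ae_bounded_law bf)).
Qed.

End laws.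

Section product.
Context {d d' : measure_display} {T : measurableType d} {T' : measurableType d'}.
Context {R : realType} (mu : probability T R) (nu : probability T' R).

Lemma has_law_fst : has_law (mu \x nu)%E mu fst.
Proof.
split=> // A mA; have -> : fst @^-1` A = A `*` [set: T'].
  by apply/seteqP; split => [x|x []].
rewrite -[RHS]mule1 -(probability_setT nu); exact: product_measure1E.
Qed.

Lemma has_law_snd : has_law (mu \x nu)%E nu snd.
Proof.
split=> // A mA; have -> : snd @^-1` A = [set: T] `*` A.
  by apply/seteqP; split => [x|x []].
rewrite -[RHS]mul1e -(probability_setT mu); exact: product_measure1E.
Qed.

Lemma Rintegral_prodM (f : T -> R) (g : T' -> R) :
  ae_bounded mu f -> ae_bounded nu g ->
  \int[(mu \x nu)%E]_w (f w.1 * g w.2) = \int[mu]_x f x * \int[nu]_y g y.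
Proof.
move=> bf bg; pose h := fun w : T * T' => f w.1 * g w.2.
have bh : ae_bounded (mu \x nu)%E h.
  by apply: ae_boundedM; [exact: (ae_bounded_law has_law_fst bf)|
    exact: (ae_bounded_law has_law_snd bg)].
have ih := ae_bounded_integrable bh.
have ifg := ae_bounded_integrable bg.
have fg : (\int[nu]_y (g y)%:E)%E = (\int[nu]_y g y)%:E.
  by rewrite /Rintegral fineK//; exact: integrable_fin_num.
rewrite {1}/Rintegral -/(h _) -(integral12_prod_meas1 ih) /fubini_F /=.
under eq_integral => x _.
  rewrite /h /=; under eq_integral do rewrite EFinM.
  rewrite integralZl// fg -EFinM; over.
rewrite -[LHS]/(\int[mu]_x (f x * _)) RintegralZr//.
exact: ae_bounded_integrable.
Qed.

End product.

Section iid_expectation.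
Context {d : measure_display} {T : measurableType d} {R : realType}.
Variables (P : probability T R) (x0 : T).

Lemma measurable_nth n i : (i < n)%N ->
  measurable_fun setT (fun t : n.-tuple T => nth x0 t i).
Proof.
move=> i_n; have := @measurable_tnth _ T n (Ordinal i_n).
by congr measurable_fun; apply/funext => t; rewrite (tnth_nth x0).
Qed.

Lemma has_law_tcons n : has_law (P \x iid P n)%E (iid P n.+1) (@tcons _ _ n).
Proof. by split=> //; exact: measurable_tcons. Qed.

(** Induction along the recursion of [iid]: coordinate 0 is the first projection of the product,
    coordinate i + 1 is coordinate i of the second. *)
Lemma has_law_nth n i : (i < n)%N ->
  has_law (iid P n) P (fun t : n.-tuple T => nth x0 t i).
Proof.
move=> i_n; split; first exact: measurable_nth.
elim: n i i_n => // n IH [|i] i_n A mA.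
  transitivity ((P \x iid P n)%E (fst @^-1` A)); first by [].
  by case: (has_law_fst P (iid P n)) => _ ->.
transitivity ((P \x iid P n)%E (snd @^-1`
   ((fun t : n.-tuple T => nth x0 t i) @^-1` A))); first by [].
case: (has_law_snd P (iid P n)) => _ ->; first exact: IH.
by rewrite -[_ @^-1` _]setTI; exact: measurable_nth.
Qed.

Lemma Rintegral_iid_prod n (f : nat -> T -> R) :
  (forall i, (i < n)%N -> ae_bounded P (f i)) ->
  \int[iid P n]_t (\prod_(i < n) f i (nth x0 t i)) =
  \prod_(i < n) \int[P]_x f i x.
Proof.
elim: n f => [|n IH] f bf.
  by rewrite big_ord0; under eq_Rintegral do rewrite big_ord0; rewrite Rintegral_cst1.
have bfS i : (i < n)%N -> ae_bounded P (f i.+1) by move=> i_n; exact: bf.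
have bt : ae_bounded (iid P n.+1) (fun t => \prod_(i < n.+1) f i (nth x0 t i)).
  apply: ae_bounded_prod => i _.
  exact: (ae_bounded_law (has_law_nth (ltn_ord i)) (bf _ (ltn_ord i))).
rewrite -(Rintegral_law (has_law_tcons n) bt) big_ord_recl.
under eq_Rintegral do rewrite big_ord_recl /=.
have bu : ae_bounded (iid P n) (fun t => \prod_(i < n) f i.+1 (nth x0 t i)).
  apply: ae_bounded_prod => i _.
  exact: (ae_bounded_law (has_law_nth (ltn_ord i)) (bfS _ (ltn_ord i))).
by rewrite (Rintegral_prodM (bf 0%N isT) bu) (IH (fun i => f i.+1)).
Qed.

End iid_expectation.

Section iid_moments.
Context {d : measure_display} {T : measurableType d} {R : realType}.
Variables (P : probability T R) (x0 : T) (n : nat).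
Local Notation X i := (fun t : n.-tuple T => nth x0 t i).

Lemma ae_bounded_nth i (f : T -> R) : (i < n)%N -> ae_bounded P f ->
  ae_bounded (iid P n) (fun t => f (nth x0 t i)).
Proof. by move=> i_n; exact: (ae_bounded_law (has_law_nth P x0 i_n)). Qed.

Lemma Rintegral_nth i (f : T -> R) : (i < n)%N -> ae_bounded P f ->
  \int[iid P n]_t f (nth x0 t i) = \int[P]_x f x.
Proof. by move=> i_n; exact: (Rintegral_law (has_law_nth P x0 i_n)). Qed.

(** Factors carry labels, such as a leaf of a clause, and read the sample at the position of their
    label. As positions are distinct, the product regroups by coordinate and independence
    applies. *)
Lemma Rintegral_iid_inj (L : finType) (Q : pred L) (pos : L -> nat) (f : L -> T -> R) :
  {in Q &, injective pos} -> (forall l, Q l -> (pos l < n)%N) ->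
  (forall l, Q l -> ae_bounded P (f l)) ->
  \int[iid P n]_t (\prod_(l | Q l) f l (nth x0 t (pos l))) =
  \prod_(l | Q l) \int[P]_x f l x.
Proof.
move=> pos_inj pos_n bf.
have fiber (F : L -> R) : \prod_(l | Q l) F l =
    \prod_(i < n) \prod_(l | Q l && (pos l == i)) F l.
  rewrite (exchange_big_dep Q)/=; last by move=> i l _ /andP[].
  apply: eq_bigr => l Ql; rewrite (big_pred1 (Ordinal (pos_n l Ql)))// => i.
  by rewrite /= Ql /= eq_sym.
(* A coordinate carries at most one label; a coordinate without label contributes the constant 1. *)
have single i : (forall l, ~~ (Q l && (pos l == i))) \/
    exists2 l0, Q l0 && (pos l0 == i) & forall l, (Q l && (pos l == i)) = (l == l0).
  have [/existsP[l0 Ql0]|/existsPn h] := boolP [exists l, Q l && (pos l == i)].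
    right; exists l0 => // l; have /andP[Q0 /eqP p0] := Ql0.
    apply/andP/eqP => [[Ql /eqP pl]|-> //]; last by rewrite p0 eqxx.
    by apply: pos_inj => //; rewrite pl.
  by left.
pose F (i : nat) x := \prod_(l | Q l && (pos l == i)) f l x.
have bF i : ae_bounded P (F i).
  by apply: ae_bounded_prod => l /andP[Ql _]; exact: bf.
rewrite fiber; transitivity (\int[iid P n]_t (\prod_(i < n) F i (nth x0 t i))).
  apply: eq_Rintegral => t _; rewrite fiber; apply: eq_bigr => i _.
  by apply: eq_bigr => l /andP[_ /eqP->].
rewrite Rintegral_iid_prod//; apply: eq_bigr => i _; rewrite /F.
case: (single i) => [h|[l0 Q0 h]].
  rewrite big_pred0 => [|l]; last exact: negbTE.
  rewrite -[RHS](Rintegral_cst1 P); apply: eq_Rintegral => x _.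
  by rewrite big_pred0// => l; exact: negbTE.
rewrite (big_pred1 l0)//; apply: eq_Rintegral => x _.
by rewrite (big_pred1 l0).
Qed.

Lemma Rintegral_iid2 i j (f g : T -> R) : i != j -> (i < n)%N -> (j < n)%N ->
  ae_bounded P f -> ae_bounded P g ->
  \int[iid P n]_t (f (nth x0 t i) * g (nth x0 t j)) =
  (\int[P]_x f x) * \int[P]_x g x.
Proof.
move=> ij i_n j_n bf bg.
have := @Rintegral_iid_inj bool predT (fun b => if b then i else j)
  (fun b => if b then f else g).
rewrite big_bool /= => <-.
- by apply: eq_Rintegral => t _; rewrite big_bool.
- by move=> [] [] _ _ // /eqP; rewrite ?(negbTE ij)// eq_sym (negbTE ij).
- by case.
- by case.
Qed.

Variables (I : Type) (z : I -> T -> R).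
Hypotheses (bz : forall a, ae_bounded P (z a)) (z0 : forall a, \int[P]_x z a x = 0).
Let S a b := \int[P]_x (z a x * z b x).

(* A monomial with an index of multiplicity one has zero expectation. *)
Lemma Rintegral_iid_moment4 p p' r r' a b c e :
  p != p' -> r != r' -> (p < n)%N -> (p' < n)%N -> (r < n)%N -> (r' < n)%N ->
  \int[iid P n]_t (z a (nth x0 t p) * z b (nth x0 t p') *
                   (z c (nth x0 t r) * z e (nth x0 t r'))) =
  ((p == r) && (p' == r'))%:R * (S a c * S b e) +
  ((p == r') && (p' == r))%:R * (S a e * S b c).
Proof.
move=> pp' rr' p_n p'_n r_n r'_n.
have [/andP[/eqP <- /eqP <-]|h1] := boolP ((p == r) && (p' == r')).
  rewrite (negbTE pp') /= mul0r addr0 mul1r -(Rintegral_iid2 pp')//;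
    try exact: ae_boundedM.
  by apply: eq_Rintegral => t _; ring.
have [/andP[/eqP <- /eqP <-]|h2] := boolP ((p == r') && (p' == r)).
  rewrite mul0r add0r mul1r -(Rintegral_iid2 pp')//;
    try exact: ae_boundedM.
  by apply: eq_Rintegral => t _; ring.
rewrite !mul0r addr0.
pose sel (u i : nat) (w : T -> R) : T -> R := if i == u then w else fun=> 1.
(* [f i] gathers those of the four factors that read coordinate [i], the others being replaced by
   1. *)
pose f i x := sel p i (z a) x * sel p' i (z b) x * (sel r i (z c) x * sel r' i (z e) x).
have bsel u i w : ae_bounded P w -> ae_bounded P (sel u i w).
  by move=> bw; rewrite /sel; case: ifP => // _; exact: ae_bounded_cst.
have bf i : ae_bounded P (f i) by do 2 apply: ae_boundedM; exact: bsel.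
have selE u w t : (u < n)%N -> \prod_(i < n) sel u i w (nth x0 t i) = w (nth x0 t u).
  move=> u_n; rewrite (bigD1 (Ordinal u_n))//= /sel eqxx big1 ?mulr1// => i.
  by rewrite -val_eqE /= => /negbTE->.
transitivity (\int[iid P n]_t (\prod_(i < n) f i (nth x0 t i))).
  by apply: eq_Rintegral => t _; rewrite !big_split /= !selE.
rewrite Rintegral_iid_prod//.
have once u w : (u < n)%N -> \int[P]_x w x = 0 -> f u = w ->
    \prod_(i < n) \int[P]_x f i x = 0.
  by move=> u_n w0 fw; rewrite (bigD1 (Ordinal u_n))//= fw w0 mul0r.
(* Neither pairing holds: if [p] equals [r] or [r'], then [p'] occurs only once; otherwise [p]
   does. *)
have [pr|pr] := eqVneq p r.
  have p'r' : p' != r' by move: h1; rewrite pr eqxx.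
  apply: (once p' (z b)) => //; apply/funext => x; rewrite /f /sel eqxx.
  by rewrite -pr (eq_sym p') (negbTE pp') (negbTE p'r'); ring.
have [pr'|pr'] := eqVneq p r'.
  have p'r : p' != r by move: h2; rewrite pr' eqxx.
  apply: (once p' (z b)) => //; apply/funext => x; rewrite /f /sel eqxx.
  by rewrite -pr' (eq_sym p' p) (negbTE pp') (negbTE p'r); ring.
apply: (once p (z a)) => //; apply/funext => x; rewrite /f /sel eqxx.
by rewrite (negbTE pp') (negbTE pr) (negbTE pr'); ring.
Qed.

End iid_moments.

(** * Weight functions *)

Section euclidean_measurable.
Context {R : realType}.

Lemma measurable_eval (I : Type) (i : I) :
  measurable_fun setT (fun f : euclidean R I => f i).
Proof.
move=> _ B mB; apply: sub_sigma_algebra; exists i => //.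
by exists B.
Qed.

Lemma measurable_euclidean d (T : measurableType d) (I : Type) (f : T -> euclidean R I) :
  (forall i, measurable_fun setT (fun x => f x i)) -> measurable_fun setT f.
Proof.
move=> mf.
apply: (@measurability _ _ T (euclidean R I) setT f (@coord_preimages R I)) => //.
by move=> _ [_ [i _ [B mB <-]] <-]; rewrite setTI; exact: (mf i).
Qed.

Lemma probability1_ae d (T : measurableType d) (mu : probability T R) (D : set T) :
  measurable D -> mu D = 1%E -> {ae mu, forall x, D x}.
Proof.
move=> mD D1; exists (~` D); split => //; first exact: measurableC.
by rewrite probability_setC// D1 subee.
Qed.

End euclidean_measurable.

Section weights.
Context {R : realType} {Omega : finType} {k : nat} (hk : (2 <= k)%N).
Local Notation q := (#|Omega|%:R : R).
Local Notation config := {ffun 'I_k -> Omega}.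
Local Notation weight := (euclidean R config).
Variables (Psi : set weight) (P : probability weight R).
Hypotheses (mPsi : measurable Psi) (wPsi : forall psi, Psi psi -> is_weight psi).
Hypotheses (cPsi : permutation_closed Psi) (PPsi : P Psi = 1%E).
Hypotheses (hSYM : SYM Psi P) (Omega_gt0 : (0 < #|Omega|)%N).

Lemma q_gt0 : 0 < q.
Proof. by rewrite ltr0n. Qed.

Lemma q_neq0 : q != 0.
Proof. by rewrite gt_eqF// q_gt0. Qed.

Lemma exprq_pred : q ^+ k = q * q ^+ k.-1.
Proof. by rewrite -exprS prednK// ltnW. Qed.

Lemma ae_Psi : {ae P, forall psi, Psi psi}.
Proof. exact: probability1_ae. Qed.

(** SYM at a single member of [Psi], which exists because [P Psi = 1], equates [q ^+ k.-1 * xi P]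
    with a non-empty sum of positive weights. *)
Lemma xi_gt0 : 0 < xi P.
Proof.
have [psi psiP] : exists psi, Psi psi.
  apply: contrapT => /forallNP Psi0; have : P Psi = 0%E.
    by rewrite (_ : Psi = set0) ?measure0//; apply/seteqP; split => // x /(Psi0 x).
  by rewrite PPsi => /eqP; rewrite onee_eq0.
have /card_gt0P[om _] := Omega_gt0.
have qk : 0 < q ^+ k.-1 by rewrite exprn_gt0 ?q_gt0.
case: hSYM => /(_ (ord_first hk) om psi psiP) h _.
rewrite -(pmulr_rgt0 _ qk) -h (bigD1 [ffun=> om]) ?ffunE//=.
apply: ltr_pwDl; first by case/andP: (wPsi psiP [ffun=> om]).
by apply: sumr_ge0 => tau _; case/andP: (wPsi psiP tau) => /ltW.
Qed.

Lemma xi_neq0 : xi P != 0.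
Proof. by rewrite gt_eqF// xi_gt0. Qed.

Lemma ae_bounded_eval (tau : config) : ae_bounded P (fun psi => psi tau).
Proof.
split; first exact: measurable_eval.
exists 2; apply: filterS ae_Psi => psi /wPsi /(_ tau) /andP[p0 p2].
by rewrite ger0_norm ltW.
Qed.

(* The probability distribution on configurations proportional to psi. *)
Definition pw (psi : weight) (tau : config) : R := psi tau / (q ^+ k * xi P).

Lemma norm_gt0 : 0 < q ^+ k * xi P.
Proof. by rewrite mulr_gt0 ?xi_gt0// exprn_gt0 ?q_gt0. Qed.

Lemma pw_ge0 psi tau : Psi psi -> 0 <= pw psi tau.
Proof.
by move=> /wPsi /(_ tau) /andP[p0 _]; rewrite /pw divr_ge0 ?ltW ?norm_gt0.
Qed.

Lemma pw_marginal psi (i : 'I_k) (om : Omega) : Psi psi ->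
  \sum_(tau : config | tau i == om) pw psi tau = q^-1.
Proof.
move=> psiP; rewrite -mulr_suml; case: hSYM => -> // _.
rewrite exprq_pred; have := xi_neq0; have := q_neq0.
have : q ^+ k.-1 != 0 by rewrite expf_neq0 ?q_neq0.
by move: (q ^+ k.-1) => x x0 q0 xi0; field; rewrite x0 q0 xi0.
Qed.

Lemma pw_sum psi : Psi psi -> \sum_(tau : config) pw psi tau = 1.
Proof.
move=> psiP; rewrite (partition_big (fun tau : config => tau (ord_first hk)) predT)//=.
under eq_bigr => om _ do rewrite pw_marginal//.
by rewrite sumr_const -[LHS]mulr_natl divff// q_neq0.
Qed.

Lemma ae_bounded_pw tau : ae_bounded P (pw ^~ tau).
Proof.
by apply: ae_boundedM; [exact: ae_bounded_eval|exact: ae_bounded_cst].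
Qed.

(** The joint law of coordinates [i] and [j] under [pw psi]; for the first two coordinates it is
    [q^-1] times [Phi]. *)
Definition pairM (i j : 'I_k) (psi : weight) (a b : Omega) : R :=
  \sum_(tau : config | (tau i == a) && (tau j == b)) pw psi tau.

Lemma pairM_sym i j psi a b : pairM i j psi a b = pairM j i psi b a.
Proof. by apply: eq_bigl => tau; rewrite andbC. Qed.

Lemma ae_bounded_pairM i j a b : ae_bounded P (fun psi => pairM i j psi a b).
Proof. by apply: ae_bounded_sum => tau _; exact: ae_bounded_pw. Qed.

(** SYM concerns images of measurable subsets of [Psi]. Arbitrary measurable sets are intersected
    with [Psi], of full measure, and a preimage under [theta] is written as an image under its
    inverse. *)
Lemma has_law_permute (theta : 'S_k) : has_law P P (permute_weight theta).
Proof.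
have mp t : measurable_fun setT (@permute_weight R Omega k t).
  by apply: measurable_euclidean => tau; exact: measurable_eval.
have pK t (psi : weight) : permute_weight t^-1%g (permute_weight t psi) = psi.
  apply/funext => tau; rewrite /permute_weight; congr psi.
  by apply/ffunP => i; rewrite !ffunE permK.
have pKV t (psi : weight) : permute_weight t (permute_weight t^-1%g psi) = psi.
  by have := pK t^-1%g psi; rewrite invgK.
have PsiI t : permute_weight t @^-1` Psi = Psi.
  apply/seteqP; split => psi /=; last exact: cPsi.
  by move=> /(cPsi t^-1%g); rewrite pK.
split; first exact: mp.
move=> A mA.
have PC : P (~` Psi) = 0%E by rewrite probability_setC// PPsi subee.
have PI (B : set weight) : measurable B -> P B = P (B `&` Psi).
  move=> mB; rewrite -[in LHS](setIT B) -(setUv Psi) setIUr measureU//;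
    try exact: measurableI; try (apply: measurableI => //; exact: measurableC).
    rewrite [X in (_ + X)%E](_ : _ = 0%E) ?adde0//.
    apply/eqP; rewrite -measure_le0 -PC; apply: le_measure; rewrite ?inE.
    - by apply: measurableI => //; exact: measurableC.
    - exact: measurableC.
    - exact: subIsetr.
  by apply/seteqP; split => x // [[_ h] [_]].
have mpA : measurable (permute_weight theta @^-1` A).
  by rewrite -[_ @^-1` _]setTI; exact: mp.
rewrite PI// [RHS]PI// (_ : _ `&` Psi = permute_weight theta^-1%g @` (A `&` Psi)).
  by case: hSYM => _ <- //; exact: measurableI.
apply/seteqP; split => psi.
  move=> [/= Ap Pp]; exists (permute_weight theta psi) => //.
  by split=> //; exact: cPsi.
move=> [phi [Ap Pp] <-]; split; last exact: cPsi.
by rewrite /= pKV.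
Qed.

Lemma pairM_permute (theta : 'S_k) i j psi a b :
  pairM (theta i) (theta j) (permute_weight theta psi) a b = pairM i j psi a b.
Proof.
rewrite /pairM (reindex_inj (h := fun tau : config => [ffun l => tau (theta^-1%g l)])).
  apply: eq_big => [tau|tau _]; first by rewrite !ffunE !permK.
  rewrite /pw /permute_weight; congr (psi _ / _).
  by apply/ffunP => l; rewrite !ffunE permK.
move=> t t' /ffunP h; apply/ffunP => l.
by have := h (theta l); rewrite !ffunE permK.
Qed.

Lemma pairM_Phi psi a b :
  pairM (ord_first hk) (ord_second hk) psi a b = q^-1 * Phi hk P psi a b.
Proof.
rewrite /pairM /pw /Phi -mulr_suml exprq_pred; move: (xi P) => x.
by rewrite !invfM; ring.
Qed.

(** Invariance of [P] moves any two distinct coordinates to the first two, where the integrand is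
    [q ^- 2] times an entry of Phi (x) Phi. *)
Lemma Rintegral_pairM2 i j a b c e : i != j ->
  \int[P]_psi (pairM i j psi a b * pairM i j psi c e) =
  q ^- 2 * Xi hk P (a, c) (b, e).
Proof.
move=> ij.
have [theta [ti tj]] : exists theta : 'S_k,
    theta i = ord_first hk /\ theta j = ord_second hk.
  pose t1 := tperm i (ord_first hk); pose t2 := tperm (t1 j) (ord_second hk).
  exists (t1 * t2)%g; rewrite !permM tpermL /t2 tpermL; split => //.
  rewrite tpermD//; first by rewrite -(tpermL i (ord_first hk)) (inj_eq perm_inj) eq_sym.
have bb i' j' : ae_bounded P (fun psi => pairM i' j' psi a b * pairM i' j' psi c e).
  by apply: ae_boundedM; exact: ae_bounded_pairM.
transitivity (\int[P]_psi (pairM (theta i) (theta j) psi a b *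
                           pairM (theta i) (theta j) psi c e)).
  rewrite -[RHS](Rintegral_law (has_law_permute theta) (bb _ _)).
  by apply: eq_Rintegral => psi _; rewrite !pairM_permute.
rewrite ti tj; transitivity
   (\int[P]_psi (q ^- 2 * tensor_mx (Phi hk P psi) (Phi hk P psi) (a, c) (b, e))).
  by apply: eq_Rintegral => psi _; rewrite !pairM_Phi /tensor_mx /= -exprVn; ring.
rewrite RintegralZ_bounded//.
have := ae_boundedZ (q ^+ 2) (bb (ord_first hk) (ord_second hk)).
congr ae_bounded; apply/funext => psi; rewrite !pairM_Phi /tensor_mx /=.
by have := q_neq0 => q0; field.
Qed.

End weights.

(** * Quadratic chaos *)

Section quad.
Context {R : realType} {L I : finType} (Q : pred L).
Implicit Types (N : L -> L -> I -> I -> R) (z : L -> I -> R).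

Definition offdiag (p : L * L) := [&& Q p.1, Q p.2 & p.2 != p.1].

(** The factor 1/2 compensates for each unordered pair of labels occurring in both orders. Without
    diagonal terms, the second moment depends on a centered [z] only through its covariance. *)
Definition quad N z : R := 2^-1 * \sum_(p : L * L | offdiag p)
  \sum_(ab : I * I) N p.1 p.2 ab.1 ab.2 * (z p.1 ab.1 * z p.2 ab.2).

Lemma sum_offdiag (F : L -> L -> R) : \sum_(p : L * L | offdiag p) F p.1 p.2 =
  \sum_(l | Q l) \sum_(l' | Q l' && (l' != l)) F l l'.
Proof. by rewrite pair_big_dep. Qed.

Lemma e2E (x : L -> R) :
  2^-1 * ((\sum_(l | Q l) x l) ^+ 2 - \sum_(l | Q l) x l ^+ 2) =
  2^-1 * \sum_(p : L * L | offdiag p) x p.1 * x p.2.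
Proof.
congr (_ * _); rewrite (sum_offdiag (fun l l' => x l * x l')) expr2 mulr_suml -sumrB.
apply: eq_bigr => l Ql; rewrite mulr_sumr (bigD1 l)//= addrC -expr2 addrK.
by apply: eq_bigl => l'; rewrite andbC andbC.
Qed.

Context {d d' : measure_display} {T : measurableType d} {T' : measurableType d'}.
Variables (mu : probability T R) (nu : probability T' R) (x0 : T') (n : nat).
Variables (N : L -> L -> I -> I -> T -> R) (z : I -> T' -> R) (pos : L -> nat).
Hypotheses (bN : forall l l' a b, Q l -> Q l' -> ae_bounded mu (N l l' a b)).
Hypotheses (bz : forall a, ae_bounded nu (z a)) (z0 : forall a, \int[nu]_x z a x = 0).
Hypotheses (pos_inj : {in Q &, injective pos}) (pos_n : forall l, Q l -> (pos l < n)%N).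
Hypothesis Nsym : forall l l' a b x, N l l' a b x = N l' l b a x.
Let S a b := \int[nu]_x (z a x * z b x).
Let qf (w : T * n.-tuple T') :=
  quad (fun l l' a b => N l l' a b w.1) (fun l a => z a (nth x0 w.2 (pos l))).

Let Z (p : L * L) (ab : I * I) (t : n.-tuple T') :=
  z ab.1 (nth x0 t (pos p.1)) * z ab.2 (nth x0 t (pos p.2)).
Let M (p : L * L) (ab : I * I) (x : T) := N p.1 p.2 ab.1 ab.2 x.

Let bM p ab : offdiag p -> ae_bounded mu (M p ab).
Proof. by move=> /and3P[Q1 Q2 _]; exact: bN. Qed.

Let bZ p ab : offdiag p -> ae_bounded (iid nu n) (Z p ab).
Proof.
move=> /and3P[Q1 Q2 _]; apply: ae_boundedM;
by apply: (ae_bounded_nth x0 _ (bz _)); exact: pos_n.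
Qed.

Lemma ae_bounded_quad : ae_bounded (mu \x iid nu n)%E qf.
Proof.
apply: ae_boundedZ; apply: ae_bounded_sum => p Cp; apply: ae_bounded_sum => ab _.
apply: ae_boundedM; first exact: (ae_bounded_law (has_law_fst _ _) (bM ab Cp)).
exact: (ae_bounded_law (has_law_snd _ _) (bZ ab Cp)).
Qed.

Let qf2E w : qf w ^+ 2 = 4^-1 * \sum_(p | offdiag p) \sum_ab
  \sum_(r | offdiag r) \sum_ce (M p ab w.1 * M r ce w.1) * (Z p ab w.2 * Z r ce w.2).
Proof.
rewrite /qf /quad exprMn expr2 -invfM -natrM; congr (_ * _).
rewrite expr2 mulr_suml; apply: eq_bigr => p _.
rewrite mulr_suml; apply: eq_bigr => ab _.
rewrite mulr_sumr; apply: eq_bigr => r _.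
rewrite mulr_sumr; apply: eq_bigr => ce _.
by rewrite /M /Z; ring.
Qed.

(** In the expanded square, centering leaves only the terms whose two pairs of labels coincide, in
    the same or in the opposite order. By symmetry of [N] both orders contribute alike, so the
    coefficient 1/4 becomes 1/2. *)
Lemma Rintegral_quad2 : \int[(mu \x iid nu n)%E]_w (qf w ^+ 2) =
  2^-1 * \sum_(p | offdiag p) \sum_(ab : I * I) \sum_(ce : I * I)
    (\int[mu]_x (N p.1 p.2 ab.1 ab.2 x * N p.1 p.2 ce.1 ce.2 x)) *
    (S ab.1 ce.1 * S ab.2 ce.2).
Proof.
under eq_Rintegral do rewrite qf2E.
have bMM p ab r ce : offdiag p -> offdiag r ->
    ae_bounded mu (fun x => M p ab x * M r ce x).
  by move=> Cp Cr; apply: ae_boundedM; exact: bM.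
have bZZ p ab r ce : offdiag p -> offdiag r ->
    ae_bounded (iid nu n) (fun t => Z p ab t * Z r ce t).
  by move=> Cp Cr; apply: ae_boundedM; exact: bZ.
have bt p ab r ce : offdiag p -> offdiag r -> ae_bounded (mu \x iid nu n)%E
    (fun w => (M p ab w.1 * M r ce w.1) * (Z p ab w.2 * Z r ce w.2)).
  move=> Cp Cr; apply: ae_boundedM.
    exact: (ae_bounded_law (has_law_fst _ _) (bMM _ ab _ ce Cp Cr)).
  exact: (ae_bounded_law (has_law_snd _ _) (bZZ _ ab _ ce Cp Cr)).
rewrite RintegralZ_bounded; last first.
  apply: ae_bounded_sum => p Cp; apply: ae_bounded_sum => ab _.
  by apply: ae_bounded_sum => r Cr; apply: ae_bounded_sum => ce _; exact: bt.
rewrite Rintegral_sum; last first.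
  move=> p Cp; apply: ae_bounded_sum => ab _.
  by apply: ae_bounded_sum => r Cr; apply: ae_bounded_sum => ce _; exact: bt.
have -> : (2^-1 : R) = 4^-1 * 2 by field.
rewrite -mulrA; congr (_ * _); rewrite mulr_sumr; apply: eq_bigr => p Cp.
rewrite Rintegral_sum; last first.
  move=> ab _.
  by apply: ae_bounded_sum => r Cr; apply: ae_bounded_sum => ce _; exact: bt.
rewrite mulr_sumr; apply: eq_bigr => ab _.
rewrite Rintegral_sum; last first.
  by move=> r Cr; apply: ae_bounded_sum => ce _; exact: bt.
pose G r ce := \int[mu]_x (M p ab x * M r ce x).
have posE l l' : Q l -> Q l' -> (pos l == pos l') = (l == l').
  by move=> Ql Ql'; apply/eqP/eqP => [/pos_inj->//|->].
transitivity (\sum_(r | offdiag r) \sum_ce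
    ((r == p)%:R * (G r ce * (S ab.1 ce.1 * S ab.2 ce.2)) +
     (r == (p.2, p.1))%:R * (G r ce * (S ab.1 ce.2 * S ab.2 ce.1)))).
  apply: eq_bigr => r Cr; rewrite Rintegral_sum; last by move=> ce _; exact: bt.
  apply: eq_bigr => ce _.
  rewrite (Rintegral_prodM (bMM _ _ _ _ Cp Cr) (bZZ _ _ _ _ Cp Cr)).
  have /and3P[Q1 Q2 p12] := Cp; have /and3P[R1 R2 r12] := Cr.
  rewrite /Z Rintegral_iid_moment4 ?pos_n//; try by rewrite posE// eq_sym.
  rewrite !posE// -/(G r ce) mulrDr !(mulrCA (G _ _)).
  congr (_ * _ + _ * _); congr (_%:R); congr nat_of_bool.
    by rewrite -pair_eqE /pair_eq /= (eq_sym r.1) (eq_sym r.2).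
  by rewrite -pair_eqE /pair_eq /= (eq_sym r.1) (eq_sym r.2) andbC.
under eq_bigr do rewrite big_split /=.
rewrite big_split /= mulr_natl mulr2n; congr (_ + _).
  rewrite (bigD1 p)//= [X in _ + X]big1 ?addr0 => [|r /andP[_ /negbTE rp]]; last first.
    by rewrite big1// => ce _; rewrite rp mul0r.
  by apply: eq_bigr => ce _; rewrite eqxx mul1r.
have Csw : offdiag (p.2, p.1).
  by case/and3P: Cp => Q1 Q2 p12; rewrite /offdiag /= Q1 Q2 eq_sym.
rewrite (bigD1 (p.2, p.1))//= [X in _ + X]big1 ?addr0 => [|r /andP[_ /negbTE rp]];
  last first.
  by rewrite big1// => ce _; rewrite rp mul0r.
rewrite (reindex_inj (h := fun ce : I * I => (ce.2, ce.1))) /=; last first.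
  by move=> [? ?] [? ?] [-> ->].
apply: eq_bigr => ce _; rewrite eqxx mul1r; congr (_ * _).
by apply: eq_Rintegral => x _; rewrite /M /= (Nsym p.2).
Qed.

End quad.

(** * Local expansion of the Bethe integrand *)

Section expansions.
Context {R : realType} {Omega : finType} {k : nat} (hk : (2 <= k)%N).
Local Notation q := (#|Omega|%:R : R).
Local Notation config := {ffun 'I_k -> Omega}.
Local Notation weight := (euclidean R config).
Local Notation last := (ord_last hk).
Variables (Psi : set weight) (P : probability weight R).
Hypotheses (wPsi : forall psi, Psi psi -> is_weight psi) (PPsi : P Psi = 1%E).
Hypotheses (hSYM : SYM Psi P) (Omega_gt0 : (0 < #|Omega|)%N).
Local Notation pw := (pw P).
Local Notation pairM := (pairM P).
Let q_neq0 := @q_neq0 R _ Omega_gt0.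

(** The relative deviation from uniform: [rho a] is [(1 + ctr rho a) / q]. *)
Definition ctr (rho : euclidean R Omega) (a : Omega) : R := q * rho a - 1.

(** The argument of the second [Lambda] of the Bethe functional, divided by [xi P]. *)
Definition edge_sum (psi : weight) (x : 'I_k -> euclidean R Omega) : R :=
  \sum_(tau : config) pw psi tau * \prod_(j < k) (1 + ctr (x j) (tau j)).

(** By SYM, [q * pw psi] restricted to the fibre of [s] is the conditional law given that the root,
    the last coordinate, has spin [s]. *)
Definition clause_msg (psi : weight) (x : 'I_k -> euclidean R Omega) (s : Omega) : R :=
  \sum_(tau : config | tau last == s) (q * pw psi tau) *
    \prod_(j < k | j != last) (1 + ctr (x j) (tau j)).

(** The argument of the first [Lambda], divided by [q * xi P ^+ g]. *)
Definition star_sum g (psi : nat -> weight) (x : nat -> 'I_k -> euclidean R Omega) : R :=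
  \sum_(s : Omega) q^-1 * \prod_(i < g) clause_msg (psi i) (x i) s.

(** Leaves of one clause interact through their pair law, since averaging over the root spin removes
    the conditioning. Leaves of different clauses are conditionally independent given the uniform
    root spin [s], and [q * pairM last j] is the law of a leaf given [s]. *)
Definition star_ker g (psi : nat -> weight) (l l' : 'I_g * 'I_k) (a b : Omega) : R :=
  if l.1 == l'.1 then pairM l.2 l'.2 (psi l.1) a b
  else \sum_(s : Omega) q^-1 * ((q * pairM last l.2 (psi l.1) s a) *
                                (q * pairM last l'.2 (psi l'.1) s b)).

Lemma sum_pw_fiber2 psi i j (G : Omega -> Omega -> R) :
  \sum_(tau : config) pw psi tau * G (tau i) (tau j) =
  \sum_(ab : Omega * Omega) pairM i j psi ab.1 ab.2 * G ab.1 ab.2.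
Proof.
rewrite (partition_big (fun tau : config => (tau i, tau j)) predT)//=.
apply: eq_bigr => ab _; rewrite /pairM mulr_suml.
apply: eq_big => [tau|tau /eqP <- //].
by rewrite -pair_eqE.
Qed.

Lemma sum_pw_fiber1 psi i (G : Omega -> R) : Psi psi ->
  \sum_(tau : config) pw psi tau * G (tau i) = q^-1 * \sum_a G a.
Proof.
move=> psiP; rewrite (partition_big (fun tau : config => tau i) predT)//= mulr_sumr.
apply: eq_bigr => a _; rewrite -(pw_marginal hk wPsi PPsi hSYM Omega_gt0 i a psiP).
by rewrite mulr_suml; apply: eq_bigr => tau /eqP ->.
Qed.

Lemma quad_pw (Q : pred 'I_k) psi (z : 'I_k -> Omega -> R) :
  \sum_(tau : config) pw psi tau *
    (2^-1 * ((\sum_(j | Q j) z j (tau j)) ^+ 2 - \sum_(j | Q j) z j (tau j) ^+ 2)) =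
  quad Q (fun i j a b => pairM i j psi a b) z.
Proof.
rewrite /quad; under eq_bigr do rewrite (e2E Q (fun j => z j _)) mulrCA mulr_sumr.
rewrite -mulr_sumr exchange_big /=; congr (_ * _); apply: eq_bigr => p _.
exact: (sum_pw_fiber2 _ _ _ (fun a b => z p.1 a * z p.2 b)).
Qed.

Section pointwise.
Variables (e : R) (e01 : 0 <= e <= 1).
Let e0 : 0 <= e. Proof. by case/andP: e01. Qed.

Definition near_uniform (rho : euclidean R Omega) :=
  (forall a, `|ctr rho a| <= e) /\ \sum_a ctr rho a = 0.

Definition edge_const : R := jet_const 1 (size (index_enum 'I_k)).

Lemma edge_const_ge0 : 0 <= edge_const.
Proof. exact: jet_const_ge0. Qed.

Let jet_factor (Q : pred 'I_k) (x : 'I_k -> euclidean R Omega) (tau : config) :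
  (forall j, Q j -> near_uniform (x j)) ->
  jet e edge_const (\prod_(j | Q j) (1 + ctr (x j) (tau j)))
    (\sum_(j | Q j) ctr (x j) (tau j))
    (2^-1 * ((\sum_(j | Q j) ctr (x j) (tau j)) ^+ 2 -
             \sum_(j | Q j) ctr (x j) (tau j) ^+ 2)).
Proof.
move=> hx; have := @jet_prod _ e 1 _ (index_enum 'I_k) Q
  (fun j => 1 + ctr (x j) (tau j)) (fun j => ctr (x j) (tau j)) (fun=> 0) e01 ler01.
rewrite big1_eq add0r; apply => j Qj; apply: jet_1D => //.
by case: (hx _ Qj).
Qed.

(** The first-order part vanishes: by SYM each coordinate is uniform under [pw psi], and the
    deviations of [x j] sum to zero. *)
Lemma jet_edge psi x : Psi psi -> (forall j, near_uniform (x j)) ->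
  jet e edge_const (edge_sum psi x) 0
    (quad predT (fun i j a b => pairM i j psi a b) (fun j a => ctr (x j) a)).
Proof.
move=> psiP hx.
have := @jet_mean _ e edge_const _ predT (pw psi) _ _ _ e0 edge_const_ge0
  (fun tau _ => pw_ge0 hk wPsi PPsi hSYM Omega_gt0 tau psiP)
  (pw_sum hk wPsi PPsi hSYM Omega_gt0 psiP)
  (fun tau _ => @jet_factor predT x tau (fun j _ => hx j)).
congr jet; last exact: (quad_pw predT _ (fun j a => ctr (x j) a)).
under eq_bigr do rewrite mulr_sumr; rewrite exchange_big big1//= => j _.
by rewrite (sum_pw_fiber1 _ (ctr (x j)))//; case: (hx j) => _ ->; rewrite mulr0.
Qed.

Let clause_lin psi x s := \sum_(tau : config | tau last == s) (q * pw psi tau) *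
  \sum_(j | j != last) ctr (x j) (tau j).

Let clause_quad psi x s := \sum_(tau : config | tau last == s) (q * pw psi tau) *
  (2^-1 * ((\sum_(j | j != last) ctr (x j) (tau j)) ^+ 2 -
             \sum_(j | j != last) ctr (x j) (tau j) ^+ 2)).

Let jet_clause psi x s : Psi psi -> (forall j, j != last -> near_uniform (x j)) ->
  jet e edge_const (clause_msg psi x s) (clause_lin psi x s) (clause_quad psi x s).
Proof.
move=> psiP hx; apply: jet_mean => //; first exact: edge_const_ge0.
- move=> tau _; rewrite mulr_ge0 ?ler0n//.
  exact: (pw_ge0 hk wPsi PPsi hSYM Omega_gt0).
- by rewrite -mulr_sumr (pw_marginal hk wPsi PPsi hSYM Omega_gt0)// divff.
- by move=> tau _; exact: jet_factor.
Qed.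

Let clause_linE psi x s : clause_lin psi x s =
  \sum_(j | j != last) \sum_a (q * pairM last j psi s a) * ctr (x j) a.
Proof.
rewrite /clause_lin; under eq_bigr do rewrite mulr_sumr.
rewrite exchange_big /=; apply: eq_bigr => j _.
rewrite (partition_big (fun tau : config => tau j) predT)//=.
apply: eq_bigr => a _; rewrite /pairM mulr_sumr mulr_suml.
by apply: eq_bigr => tau /andP[_ /eqP ->].
Qed.

Let mean_msg (f : weight -> ('I_k -> euclidean R Omega) -> config -> R) psi x :
  \sum_(s : Omega) q^-1 * (\sum_(tau : config | tau last == s)
     (q * pw psi tau) * f psi x tau) = \sum_(tau : config) pw psi tau * f psi x tau.
Proof.
rewrite [RHS](partition_big (fun tau : config => tau last) predT)//=.
apply: eq_bigr => s _; rewrite mulr_sumr; apply: eq_bigr => tau _.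
by field.
Qed.

Let quad_star g (psi : nat -> weight) (x : nat -> 'I_k -> euclidean R Omega) :
  quad (fun l : 'I_g * 'I_k => l.2 != last) (star_ker psi)
    (fun l a => ctr (x l.1 l.2) a) =
  \sum_(i < g) quad (fun j => j != last) (fun j j' a b => pairM j j' (psi i) a b)
    (fun j a => ctr (x i j) a) +
  \sum_s q^-1 * (2^-1 * \sum_(p : 'I_g * 'I_g | offdiag predT p)
    clause_lin (psi p.1) (x p.1) s * clause_lin (psi p.2) (x p.2) s).
Proof.
pose T (i i' : 'I_g) (j j' : 'I_k) := \sum_(ab : Omega * Omega)
  star_ker psi (i, j) (i', j') ab.1 ab.2 * (ctr (x i j) ab.1 * ctr (x i' j') ab.2).
rewrite {1}/quad.
transitivity (2^-1 * \sum_i \sum_i' \sum_(j | j != last)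
  \sum_(j' | (j' != last) && ((i', j') != (i, j))) T i i' j j').
  congr (_ * _); rewrite (sum_offdiag _ (fun l l' => \sum_(ab : Omega * Omega)
    star_ker psi l l' ab.1 ab.2 * (ctr (x l.1 l.2) ab.1 * ctr (x l'.1 l'.2) ab.2))).
  rewrite -(pair_big predT (fun j => j != last) (fun i j =>
    \sum_(l' | (l'.2 != last) && (l' != (i, j))) T i l'.1 j l'.2)) /=.
  apply: eq_bigr => i _; rewrite [RHS]exchange_big /=; apply: eq_bigr => j _.
  rewrite [RHS]pair_big_dep /=; apply: eq_big => [[i' j']|[i' j'] _] //.
rewrite mulr_sumr.
have -> : \sum_s q^-1 * (2^-1 * \sum_(p : 'I_g * 'I_g | offdiag predT p)
    clause_lin (psi p.1) (x p.1) s * clause_lin (psi p.2) (x p.2) s) =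
  \sum_(i < g) 2^-1 * \sum_(i' < g | i' != i) \sum_s q^-1 *
    (clause_lin (psi i) (x i) s * clause_lin (psi i') (x i') s).
  under eq_bigr do rewrite mulrCA mulr_sumr.
  rewrite -mulr_sumr exchange_big /= -mulr_sumr; congr (_ * _).
  rewrite (sum_offdiag _ (fun i i' : 'I_g => \sum_s q^-1 *
    (clause_lin (psi i) (x i) s * clause_lin (psi i') (x i') s))).
  by apply: eq_bigr => i _; apply: eq_bigl.
rewrite -big_split /=; apply: eq_bigr => i _; rewrite -mulrDr; congr (_ * _).
rewrite (bigD1 i)//=; congr (_ + _).
  rewrite (sum_offdiag _ (fun j j' => \sum_(ab : Omega * Omega)
    pairM j j' (psi i) ab.1 ab.2 * (ctr (x i j) ab.1 * ctr (x i j') ab.2))).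
  apply: eq_bigr => j _; apply: eq_big => [j'|j' _].
    by rewrite -pair_eqE /pair_eq /= eqxx.
  by apply: eq_bigr => ab _; rewrite /star_ker /= eqxx.
apply: eq_bigr => i' i'i.
transitivity (\sum_s \sum_(j | j != last) \sum_(j' | j' != last) \sum_a \sum_b
  q^-1 * ((q * pairM last j (psi i) s a) * (q * pairM last j' (psi i') s b)) *
  (ctr (x i j) a * ctr (x i' j') b)).
  rewrite [RHS]exchange_big /=; apply: eq_bigr => j _.
  rewrite [RHS]exchange_big /=; apply: eq_big => [j'|j' _].
    by rewrite -pair_eqE /pair_eq /= (negbTE i'i) andbT.
  rewrite /T [RHS]exchange_big /=.
  under [RHS]eq_bigr do rewrite exchange_big /=.
  rewrite [RHS]pair_bigA /=; apply: eq_bigr => ab _.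
  by rewrite /star_ker /= eq_sym (negbTE i'i) mulr_suml.
apply: eq_bigr => s _; rewrite !clause_linE mulr_suml mulr_sumr.
apply: eq_bigr => j _; rewrite mulr_sumr mulr_sumr; apply: eq_bigr => j' _.
rewrite mulr_suml mulr_sumr; apply: eq_bigr => a _.
rewrite !mulr_sumr; apply: eq_bigr => b _; ring.
Qed.

(** Two nested products, over clauses and over leaves. It is unbounded in [g], hence the cutoff on
    degrees. *)
Definition star_const g : R := jet_const edge_const (size (index_enum 'I_g)).

(** The linear part of a clause need not vanish given the root spin; only its mean over [s] does.
    Products of linear parts of different clauses therefore survive at second order, and they are
    the source of |Xi S|^2. *)
Lemma jet_star g psi x : (forall i, (i < g)%N -> Psi (psi i)) ->
  (forall i j, (i < g)%N -> j != last -> near_uniform (x i j)) ->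
  jet e (star_const g) (star_sum g psi x) 0
    (quad (fun l : 'I_g * 'I_k => l.2 != last) (star_ker psi)
      (fun l a => ctr (x l.1 l.2) a)).
Proof.
move=> psiP hx.
have hs s := @jet_prod _ e edge_const _ (index_enum 'I_g) predT _ _ _ e01 edge_const_ge0
  (fun i _ => jet_clause s (psiP i (ltn_ord i)) (fun j => hx i j (ltn_ord i))).
have qi0 : 0 <= q^-1 by rewrite invr_ge0 ler0n.
have sq : \sum_(s : Omega) q^-1 = 1.
  by rewrite sumr_const -[LHS]mulr_natl divff.
have := @jet_mean _ e (star_const g) _ predT (fun=> q^-1) _ _ _ e0
  (jet_const_ge0 _ edge_const_ge0) _ sq (fun s _ => hs s).
move=> /(_ (fun _ _ => qi0)); congr jet.
  under eq_bigr do rewrite mulr_sumr; rewrite exchange_big big1//= => i _.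
  rewrite (mean_msg (fun psi x tau => \sum_(j | j != last) ctr (x j) (tau j))).
  under eq_bigr do rewrite mulr_sumr; rewrite exchange_big big1//= => j jl.
  rewrite (sum_pw_fiber1 _ (ctr (x i j))); last exact: psiP.
  by case: (hx i j (ltn_ord i) jl) => _ ->; rewrite mulr0.
rewrite quad_star; under eq_bigr do rewrite mulrDr; rewrite big_split /=.
congr (_ + _).
  under eq_bigr do rewrite mulr_sumr; rewrite exchange_big; apply: eq_bigr => i _ /=.
  rewrite -(quad_pw _ _ (fun j a => ctr (x i j) a)).
  exact: (mean_msg (fun psi x tau => 2^-1 *
    ((\sum_(j | j != last) ctr (x j) (tau j)) ^+ 2 -
       \sum_(j | j != last) ctr (x j) (tau j) ^+ 2))).
by apply: eq_bigr => s _; rewrite e2E.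
Qed.

End pointwise.
End expansions.

(** * Entropy of a quantity with vanishing first-order part *)

Section entropy_jets.
Context {R : realType}.

(** Separates the normalization: [star_sum] and [edge_sum] have mean 1, so the first summand
    contributes exactly [ln c] to the expectation. *)
Lemma Lambda_scale (c y : R) : 0 < c -> 0 <= y ->
  c^-1 * Lambda (c * y) = y * ln c + Lambda y.
Proof.
move=> c0; rewrite le_eqVlt => /predU1P[<-|y0]; rewrite /Lambda.
  by rewrite mulr0 !mul0r mulr0 addr0.
by rewrite lnM ?posrE//; field; rewrite gt_eqF.
Qed.

Lemma measurable_LambdaB d (T : measurableType d) (c1 c2 c3 c4 c5 : R) (f h : T -> R) :
  measurable_fun setT f -> measurable_fun setT h ->
  measurable_fun setT
    (fun w => c1 * Lambda (c2 * f w) - c3 * (c4 * Lambda (c5 * h w))).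
Proof.
have mL (u : T -> R) : measurable_fun setT u ->
    measurable_fun setT (fun w => Lambda (u w)).
  move=> mu; apply: measurable_funM => //.
  exact: measurableT_comp (@measurable_ln R) _.
move=> mf mh; apply: measurable_funB.
  by apply: measurable_funM => //; apply: mL; exact: measurable_funM.
do 2 apply: measurable_funM => //.
by apply: mL; exact: measurable_funM.
Qed.

Lemma Lambda_ge (y : R) : 0 <= y -> y - 1 <= Lambda y.
Proof.
rewrite le_eqVlt => /predU1P[<-|y0]; last exact: Lambda_tangent.
by rewrite /Lambda mul0r sub0r oppr_le0.
Qed.

(** With s = y - 1, the first summand pays for replacing s^2 / 2 by b^2 / 2, at most (3/2) C^2 e^5;
    the second is the Taylor remainder 4 |s|^3 with |s| <= 2 C e^2. *)
Definition entropy_const (C : R) : R := 2 * C ^+ 2 + 32 * C ^+ 3.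

Lemma entropy_const_ge0 C : 0 <= C -> 0 <= entropy_const C.
Proof. by move=> C0; rewrite addr_ge0// mulr_ge0// exprn_ge0. Qed.

Lemma entropy_jet (e C y b : R) : 0 <= e <= 1 -> 0 <= C -> 4 * C * e ^+ 2 <= 1 ->
  jet e C y 0 b ->
  `|Lambda y - (y - 1) - b ^+ 2 / 2| <= entropy_const C * e ^+ 5.
Proof.
move=> /andP[e0 e1] C0 Ce [_ hb]; set s := y - 1; rewrite subr0 => hs.
have e2 : 0 <= e ^+ 2 by rewrite exprn_ge0.
have e3 : e ^+ 3 <= e ^+ 2 by rewrite exprSr ler_piMr.
have Ce3 : C * e ^+ 3 <= C * e ^+ 2 by rewrite ler_wpM2l.
have s2 : `|s| <= 2 * C * e ^+ 2.
  have -> : s = b + (s - b) by ring.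
  apply: le_trans (ler_normD _ _) _; apply: le_trans (lerD hb hs) _; lra.
have sh : `|s| <= 2^-1 by apply: le_trans s2 _; lra.
have := Lambda1D_taylor2 sh.
have -> : 1 + s = y by rewrite /s addrC subrK.
rewrite -/(Lambda y) => hL.
have h1 : `|(s ^+ 2 - b ^+ 2) / 2| <= 2 * C ^+ 2 * e ^+ 5.
  have -> : (s ^+ 2 - b ^+ 2) / 2 = 2^-1 * ((s - b) * (s + b)) by field.
  rewrite normrM ger0_norm ?invr_ge0// normrM.
  have sb : `|s + b| <= 3 * C * e ^+ 2.
    by apply: le_trans (ler_normD _ _) _; apply: le_trans (lerD s2 hb) _; lra.
  have := ler_pM (normr_ge0 _) (normr_ge0 _) hs sb.
  have -> : C * e ^+ 3 * (3 * C * e ^+ 2) = 3 * (C ^+ 2 * e ^+ 5) by ring.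
  have : 0 <= C ^+ 2 * e ^+ 5 by rewrite mulr_ge0// exprn_ge0.
  lra.
have h2 : 4 * `|s| ^+ 3 <= 32 * C ^+ 3 * e ^+ 5.
  have : `|s| ^+ 3 <= (2 * C * e ^+ 2) ^+ 3 by rewrite lerXn2r ?nnegrE// !mulr_ge0.
  have -> : (2 * C * e ^+ 2) ^+ 3 = 8 * (C ^+ 3 * (e ^+ 5 * e)) by ring.
  have : C ^+ 3 * (e ^+ 5 * e) <= C ^+ 3 * e ^+ 5.
    by rewrite ler_wpM2l ?exprn_ge0// ler_piMr ?exprn_ge0.
  lra.
have -> : Lambda y - s - b ^+ 2 / 2 =
    (Lambda y - s - s ^+ 2 / 2) + (s ^+ 2 - b ^+ 2) / 2 by field.
apply: le_trans (ler_normD _ _) _; rewrite /entropy_const [leRHS]mulrDl [leRHS]addrC.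
by apply: lerD => //; exact: le_trans hL h2.
Qed.

End entropy_jets.

(** * Counting pairs of leaves *)

Section counting.
Context {R : realType}.

Lemma natr_predE n : (0 < n)%N -> n.-1%:R = n%:R - 1 :> R.
Proof. by case: n => // n _; rewrite -natr1 addrK. Qed.

Lemma sum_offdiag_ord k (c : R) :
  \sum_(p : 'I_k * 'I_k | offdiag predT p) c = k%:R * (k%:R - 1) * c.
Proof.
rewrite (sum_offdiag predT (fun _ _ => c)).
under eq_bigr => l _.
  rewrite sumr_const (_ : #|_| = k.-1); last by rewrite cardC1 card_ord.
  over.
rewrite sumr_const card_ord; have [->|k0] := posnP k; first by rewrite !mul0r mulr0n.
by rewrite -[LHS]mulr_natl -[c *+ _]mulr_natl natr_predE// mulrA.
Qed.

(** There are [g] clauses with [k - 1] leaves each; a leaf has [k - 2] partners in its own clause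
    and [(g - 1) (k - 1)] in the others. *)
Lemma sum_offdiag_star g k (m : 'I_k) (al be : R) : (2 <= k)%N ->
  \sum_(p : ('I_g * 'I_k) * ('I_g * 'I_k) | offdiag (fun l => l.2 != m) p)
     (if p.1.1 == p.2.1 then al else be) =
  g%:R * (k%:R - 1) * (k%:R - 2) * al + g%:R * (g%:R - 1) * (k%:R - 1) ^+ 2 * be.
Proof.
move=> hk; rewrite (sum_offdiag _ (fun l l' => if l.1 == l'.1 then al else be)).
have sum_ne (c : R) : \sum_(j < k | j != m) c = (k%:R - 1) * c.
  rewrite sumr_const (_ : #|_| = k.-1); last by rewrite cardC1 card_ord.
  by rewrite -[LHS]mulr_natl natr_predE// ltnW.
have sum_ne2 j (c : R) : j != m ->
    \sum_(j' < k | (j' != m) && (j' != j)) c = (k%:R - 2) * c.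
  move=> jm; have := sum_ne c; rewrite (bigD1 j)//= => h.
  have -> : (k%:R - 2) * c = (k%:R - 1) * c - c by ring.
  by rewrite -h [c + _]addrC addrK.
have sum_neg (i : 'I_g) (c : R) : \sum_(i' < g | i' != i) c = (g%:R - 1) * c.
  rewrite sumr_const (_ : #|_| = g.-1); last by rewrite cardC1 card_ord.
  rewrite -[LHS]mulr_natl natr_predE//; exact: leq_ltn_trans (leq0n i) (ltn_ord i).
rewrite -(pair_big predT (fun j => j != m) (fun (i : 'I_g) j => \sum_(l' : 'I_g * 'I_k |
  (l'.2 != m) && (l' != (i, j))) (if i == l'.1 then al else be))) /=.
transitivity (\sum_(i < g) \sum_(j < k | j != m)
   ((k%:R - 2) * al + (g%:R - 1) * ((k%:R - 1) * be))); last first.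
  under eq_bigr do rewrite sum_ne.
  by rewrite sumr_const card_ord -[LHS]mulr_natl; ring.
apply: eq_bigr => i _; apply: eq_bigr => j jm.
transitivity (\sum_(i' < g) \sum_(j' < k | (j' != m) && ((i', j') != (i, j)))
   (if i == i' then al else be)).
  by rewrite [RHS]pair_big_dep; apply: eq_big => [[]|[]].
rewrite (bigD1 i)//=; congr (_ + _).
  rewrite eqxx -(sum_ne2 _ _ jm); apply: eq_bigl => j'.
  by rewrite -pair_eqE /pair_eq /= eqxx.
rewrite -(sum_neg i); apply: eq_bigr => i' ii'.
rewrite eq_sym (negbTE ii') -sum_ne; apply: eq_bigl => j'.
by rewrite -pair_eqE /pair_eq /= (negbTE ii') andbT.
Qed.

(** A squared kernel carries one pair of spins per factor, whereas [Xi] is indexed by the two spins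
    that the factors have at a common coordinate; the regrouping passes from one to the other. *)
Lemma sum_pair_shuffle (I : finType) (F : I -> I -> I -> I -> R) :
  \sum_(ab : I * I) \sum_(ce : I * I) F ab.1 ab.2 ce.1 ce.2 =
  \sum_(u : I * I) \sum_(v : I * I) F u.1 v.1 u.2 v.2.
Proof.
transitivity (\sum_a \sum_b \sum_c \sum_e F a b c e).
  rewrite [RHS]pair_bigA /=; apply: eq_bigr => ab _.
  by rewrite [RHS]pair_bigA.
rewrite -(pair_bigA _ (fun a c => \sum_(v : I * I) F a v.1 c v.2)) /=.
apply: eq_bigr => a _; rewrite exchange_big /=; apply: eq_bigr => c _.
by rewrite pair_bigA.
Qed.

End counting.

(** * Expansion of the Bethe functional at fixed degree *)

Section bethe_expansion.
Context {R : realType} {Omega : finType} {k : nat} (hk : (2 <= k)%N).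
Local Notation q := (#|Omega|%:R : R).
Local Notation config := {ffun 'I_k -> Omega}.
Local Notation weight := (euclidean R config).
Local Notation last := (ord_last hk).
Variables (Psi : set weight) (P : probability weight R).
Hypotheses (mPsi : measurable Psi) (wPsi : forall psi, Psi psi -> is_weight psi).
Hypotheses (cPsi : permutation_closed Psi) (PPsi : P Psi = 1%E).
Hypotheses (hSYM : SYM Psi P) (Omega_gt0 : (0 < #|Omega|)%N).
Variables (pi : probability (euclidean R Omega) R) (e : R).
Hypotheses (e01 : 0 <= e <= 1) (pi_near : {ae pi, forall rho, near_uniform e rho}).
Hypothesis pi_mean : forall a, \int[pi]_rho rho a = q^-1.
Let q0 := @q_neq0 R _ Omega_gt0.
Let xi0 := xi_neq0 hk wPsi PPsi hSYM Omega_gt0.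

Let psi0 : weight := fun=> 0.
Let rho0 : euclidean R Omega := fun=> 0.

Definition cov (u : Omega * Omega) : R := \int[pi]_rho (ctr rho u.1 * ctr rho u.2).

(** With S the covariance [cov], this is <S, Xi S>, and [energy2] is |Xi S|^2. *)
Definition energy : R := inner (Xi_op hk P cov) cov.
Definition energy2 : R := inner (Xi_op hk P cov) (Xi_op hk P cov).

Lemma ae_bounded_ctr a : ae_bounded pi (fun rho => ctr rho a).
Proof.
split; last by exists e; apply: filterS pi_near => rho [].
apply: measurable_funB => //; apply: measurable_funM => //; exact: measurable_eval.
Qed.

Lemma ae_bounded_1ctr a : ae_bounded pi (fun rho => 1 + ctr rho a).
Proof. by apply: ae_boundedD; [exact: ae_bounded_cst|exact: ae_bounded_ctr]. Qed.

Lemma Rintegral_1ctr a : \int[pi]_rho (1 + ctr rho a) = 1.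
Proof.
transitivity (\int[pi]_rho (q * rho a)).
  by apply: eq_Rintegral => rho _; rewrite /ctr; ring.
have ba : ae_bounded pi (fun rho => rho a).
  have := ae_boundedZ q^-1 (ae_bounded_1ctr a); congr ae_bounded.
  by apply/funext => rho; rewrite /ctr; field.
by rewrite RintegralZ_bounded// pi_mean divff.
Qed.

Lemma Rintegral_ctr a : \int[pi]_rho ctr rho a = 0.
Proof.
have := Rintegral_1ctr a; rewrite RintegralD_bounded ?Rintegral_cst1.
- by move=> /eqP; rewrite -subr_eq0 addrAC subrr add0r => /eqP.
- exact: ae_bounded_cst.
- exact: ae_bounded_ctr.
Qed.

(** A weight is [q ^+ k * xi P] times [pw], and a message is [(1 + ctr) / q]. A clause with its
    [k - 1] messages keeps a factor [q xi], whose [q] goes into [clause_msg]; the edge with [k]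
    messages keeps [xi]. *)
Lemma bethe_integrandE d g (psis : seq weight) (rhos : seq (euclidean R Omega)) :
  let psi i := nth psi0 psis i in let rho j := nth rho0 rhos j in
  bethe_integrand hk P d g psis rhos =
  (q * xi P ^+ g)^-1 * Lambda ((q * xi P ^+ g) *
    star_sum hk P g psi (fun i j => rho (k * i.+1 + j)%N)) -
  d * (k%:R - 1) / k%:R * ((xi P)^-1 *
     Lambda (xi P * edge_sum P (psi 0%N) (fun j => rho j))).
Proof.
move=> psi rho.
have k0 : (k%:R : R) != 0 by rewrite pnatr_eq0 -lt0n ltnW.
have ctrE (r : euclidean R Omega) a : 1 + ctr r a = q * r a by rewrite /ctr; ring.
have pq : \prod_(j < k | j != last) q = q ^+ k.-1 :> R.
  by rewrite prodr_const cardC1 card_ord.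
have qk : q ^+ k != 0 by rewrite expf_neq0.
have qk1 : q ^+ k.-1 != 0 by rewrite expf_neq0.
rewrite /bethe_integrand -/psi0 -/rho0; congr (_ * Lambda _ - _).
  have qq (y c : R) : q * c * (q^-1 * y) = c * y by field.
  rewrite /star_sum -mulr_sumr qq.
  rewrite mulr_sumr; apply: eq_bigr => s _.
  have -> : xi P ^+ g = \prod_(i < g) xi P by rewrite prodr_const card_ord.
  rewrite -big_split /=; apply: eq_bigr => i _.
  rewrite mulr_sumr; apply: eq_bigr => tau _.
  under [in RHS]eq_bigr do rewrite ctrE.
  rewrite big_split /= pq.
  rewrite /pw (exprq_pred hk); move: xi0; rewrite -/(psi _).
  move: (xi P) (\prod_(_ < k | _) _) => x pr x0; field.
  by rewrite q0 x0 qk1.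
have xiq (x y : R) : x != 0 ->
    d * (k%:R - 1) / (k%:R * x) * y = d * (k%:R - 1) / k%:R * (x^-1 * y).
  by move=> x0; field; rewrite k0 x0.
rewrite xiq//; congr (_ * (_ * Lambda _)).
rewrite mulr_sumr; apply: eq_bigr => tau _.
under [in RHS]eq_bigr do rewrite ctrE.
rewrite big_split /= prodr_const card_ord /pw; move: xi0; rewrite -/(psi _).
by move: (xi P) (\prod_(_ < k) _) => x pr x0; field; rewrite x0 qk.
Qed.

Section fixed_degree.
Variable g : nat.
Local Notation W := (iid P g.+1 \x iid pi (k * g.+1))%E.
Let psi (w : g.+1.-tuple weight * (k * g.+1).-tuple (euclidean R Omega)) (i : nat) :=
  nth psi0 w.1 i.
Let rho (w : g.+1.-tuple weight * (k * g.+1).-tuple (euclidean R Omega)) (j : nat) :=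
  nth rho0 w.2 j.
Let star w := star_sum hk P g (psi w) (fun i j => rho w (k * i.+1 + j)%N).
Let edge w := edge_sum P (psi w 0%N) (fun j => rho w j).

Let ae_good : {ae W, forall w, (forall i, (i < g.+1)%N -> Psi (psi w i)) /\
  forall j, (j < k * g.+1)%N -> near_uniform e (rho w j)}.
Proof.
have h1 : {ae W, forall w, forall i : 'I_g.+1, Psi (psi w i)}.
  apply: filter_forall => i.
  have := ae_law (has_law_nth P psi0 (ltn_ord i)) (ae_Psi mPsi PPsi).
  exact: (ae_law (has_law_fst _ _)).
have h2 : {ae W, forall w, forall j : 'I_(k * g.+1), near_uniform e (rho w j)}.
  apply: filter_forall => j.
  have := ae_law (has_law_nth pi rho0 (ltn_ord j)) pi_near.
  exact: (ae_law (has_law_snd _ _)).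
apply: filterS2 h1 h2 => w h1 h2; split => [i i_g|j j_k].
  exact: (h1 (Ordinal i_g)).
exact: (h2 (Ordinal j_k)).
Qed.

(** Block 0 of [k] messages serves the edge term and block [i.+1] serves clause [i], so [g.+1]
    blocks suffice. *)
Let pos_lt i (j : 'I_k) : (i < g)%N -> (k * i.+1 + j < k * g.+1)%N.
Proof.
move=> i_g; apply: (@leq_trans (k * i.+2)); last by rewrite leq_mul2l ltnS i_g orbT.
by rewrite (mulnS k i.+1) addnC ltn_add2r.
Qed.

Let pos0_lt (j : 'I_k) : (j < k * g.+1)%N.
Proof. by rewrite mulnS ltn_addr. Qed.

Let pos_inj i i' (j j' : 'I_k) :
  (k * i.+1 + j = k * i'.+1 + j')%N -> i = i' /\ j = j'.
Proof.
move=> h; have k0 : (0 < k)%N by exact: ltnW.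
have := congr1 (divn^~ k) h; have := congr1 (modn^~ k) h.
rewrite !(mulnC k) !modnMDl !modn_small// !divnMDl// !divn_small// !addn0.
by move=> /val_inj -> [->].
Qed.

Let bfst i (f : weight -> R) : (i < g.+1)%N -> ae_bounded P f ->
  ae_bounded W (fun w => f (psi w i)).
Proof.
by move=> i_g bf; exact: (ae_bounded_law (has_law_fst _ _) (ae_bounded_nth psi0 i_g bf)).
Qed.

Let bsnd j (f : euclidean R Omega -> R) : (j < k * g.+1)%N -> ae_bounded pi f ->
  ae_bounded W (fun w => f (rho w j)).
Proof.
by move=> j_k bf; exact: (ae_bounded_law (has_law_snd _ _) (ae_bounded_nth rho0 j_k bf)).
Qed.

Let bpw := ae_bounded_pw mPsi wPsi PPsi.

Lemma ae_bounded_edge : ae_bounded W edge.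
Proof.
apply: ae_bounded_sum => tau _; apply: ae_boundedM.
  exact: (bfst _ (bpw tau)).
by apply: ae_bounded_prod => j _; exact: (bsnd (pos0_lt j) (ae_bounded_1ctr (tau j))).
Qed.

Lemma ae_bounded_star : ae_bounded W star.
Proof.
apply: ae_bounded_sum => s _; apply: ae_boundedZ; apply: ae_bounded_prod => i _.
apply: ae_bounded_sum => tau _; apply: ae_boundedM.
  have i_g : (i < g.+1)%N by rewrite ltnS ltnW.
  by apply: ae_boundedZ; exact: (bfst i_g (bpw tau)).
apply: ae_bounded_prod => j _.
exact: (bsnd (pos_lt _ (ltn_ord i)) (ae_bounded_1ctr (tau j))).
Qed.

Lemma Rintegral_edge : \int[W]_w edge w = 1.
Proof.
rewrite Rintegral_sum; last first.
  move=> tau _; apply: ae_boundedM; first exact: (bfst _ (bpw tau)).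
  by apply: ae_bounded_prod => j _; exact: (bsnd (pos0_lt j) (ae_bounded_1ctr (tau j))).
transitivity (\sum_tau \int[P]_psi pw P psi tau).
  apply: eq_bigr => tau _.
  rewrite (@Rintegral_prodM _ _ _ _ _ (iid P g.+1) (iid pi (k * g.+1))
    (fun t => pw P (nth psi0 t 0) tau)
    (fun t => \prod_(j < k) (1 + ctr (nth rho0 t j) (tau j)))); first last.
  - apply: ae_bounded_prod => j _.
    exact: (ae_bounded_nth rho0 (pos0_lt j) (ae_bounded_1ctr (tau j))).
  - exact: (ae_bounded_nth psi0 _ (bpw tau)).
  rewrite (Rintegral_nth psi0 _ (bpw tau))// (@Rintegral_iid_inj _ _ _ pi rho0 _ _ predT
    (fun j : 'I_k => j : nat) (fun j r => 1 + ctr r (tau j))); last 3 first.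
  - by move=> j j' _ _ /val_inj.
  - by move=> j _; exact: pos0_lt.
  - by move=> j _; exact: ae_bounded_1ctr.
  by rewrite big1 ?mulr1// => j _; exact: Rintegral_1ctr.
rewrite -Rintegral_sum; last by move=> tau _; exact: bpw.
rewrite -[RHS](Rintegral_cst1 P); congr fine.
apply: ae_eq_integral => //.
- apply/measurable_EFinP; apply: ae_bounded_measurable.
  by apply: ae_bounded_sum => tau _; exact: bpw.
- apply: filterS (ae_Psi mPsi PPsi) => p pP _.
  by rewrite (pw_sum hk wPsi PPsi hSYM Omega_gt0 pP).
Qed.

(** For a fixed root spin, the product over clauses of sums over configurations is expanded into a
    sum over families of configurations, integrated termwise by independence, and folded back. Each
    factor [1 + ctr] has mean 1, and each clause then has total mass 1 by the uniform marginal. *)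
Lemma Rintegral_star : \int[W]_w star w = 1.
Proof.
have i_g (i : 'I_g) : (i < g.+1)%N by rewrite ltnS ltnW.
pose G (i : 'I_g) (tau : config) w := (q * pw P (psi w i) tau) *
  \prod_(j < k | j != last) (1 + ctr (rho w (k * i.+1 + j)%N) (tau j)).
have bG i tau : ae_bounded W (G i tau).
  apply: ae_boundedM; first by apply: ae_boundedZ; exact: (bfst (i_g i) (bpw tau)).
  apply: ae_bounded_prod => j _.
  exact: (bsnd (pos_lt _ (ltn_ord i)) (ae_bounded_1ctr (tau j))).
rewrite Rintegral_sum; last first.
  move=> s _; apply: ae_boundedZ; apply: ae_bounded_prod => i _.
  by apply: ae_bounded_sum => tau _; exact: bG.
transitivity (\sum_(s : Omega) q^-1 : R); last first.
  by rewrite sumr_const -[LHS]mulr_natl divff.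
apply: eq_bigr => s _; rewrite RintegralZ_bounded; last first.
  by apply: ae_bounded_prod => i _; apply: ae_bounded_sum => tau _; exact: bG.
rewrite -[RHS]mulr1; congr (_ * _).
transitivity (\int[W]_w (\sum_(t in family (fun _ : 'I_g =>
    [pred tau : config | tau last == s])) \prod_(i < g) G i (t i) w)).
  apply: eq_Rintegral => w _.
  exact: (bigA_distr_big_dep (fun _ : 'I_g => [pred tau : config | tau last == s])
    (fun i tau => G i tau w)).
rewrite Rintegral_sum; last by move=> t _; apply: ae_bounded_prod => i _; exact: bG.
transitivity (\sum_(t in family (fun _ : 'I_g => [pred tau : config | tau last == s]))
   \prod_(i < g) \int[P]_p (q * pw P p (t i))).
  apply: eq_bigr => t _.
  transitivity (\int[W]_w ((\prod_(i < g) (q * pw P (psi w i) (t i))) *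
    \prod_(l : 'I_g * 'I_k | l.2 != last)
       (1 + ctr (rho w (k * l.1.+1 + l.2)%N) (t l.1 l.2)))).
    apply: eq_Rintegral => w _; rewrite big_split /=; congr (_ * _).
    by rewrite pair_big_dep.
  rewrite (@Rintegral_prodM _ _ _ _ _ (iid P g.+1) (iid pi (k * g.+1))
    (fun u => \prod_(i < g) (q * pw P (nth psi0 u i) (t i)))
    (fun u => \prod_(l : 'I_g * 'I_k | l.2 != last)
       (1 + ctr (nth rho0 u (k * l.1.+1 + l.2)%N) (t l.1 l.2)))); first last.
  - apply: ae_bounded_prod => l _.
    exact: (ae_bounded_nth rho0 (pos_lt _ (ltn_ord l.1)) (ae_bounded_1ctr _)).
  - apply: ae_bounded_prod => i _; apply: ae_boundedZ.
    exact: (ae_bounded_nth psi0 (i_g i) (bpw (t i))).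
  rewrite (@Rintegral_iid_inj _ _ _ P psi0 _ _ predT
    (fun i : 'I_g => i : nat) (fun i p => q * pw P p (t i))); last 3 first.
  - by move=> i i' _ _ /val_inj.
  - by move=> i _; exact: i_g.
  - by move=> i _; apply: ae_boundedZ; exact: bpw.
  rewrite (@Rintegral_iid_inj _ _ _ pi rho0 _ _ (fun l : 'I_g * 'I_k => l.2 != last)
    (fun l => k * l.1.+1 + l.2)%N (fun l r => 1 + ctr r (t l.1 l.2))); last 3 first.
  - by move=> [i j] [i' j'] _ _ /= /pos_inj[/val_inj -> ->].
  - by move=> l _; exact: pos_lt.
  - by move=> l _; exact: ae_bounded_1ctr.
  by rewrite [X in _ * X]big1 ?mulr1// => l _; exact: Rintegral_1ctr.
rewrite -(bigA_distr_big_dep (fun _ : 'I_g => [pred tau : config | tau last == s])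
    (fun i tau => \int[P]_p (q * pw P p tau))).
rewrite big1// => i _.
rewrite -Rintegral_sum; last by move=> tau _; apply: ae_boundedZ; exact: bpw.
rewrite -[RHS](Rintegral_cst1 P); congr fine.
apply: ae_eq_integral => //.
- apply/measurable_EFinP; apply: ae_bounded_measurable.
  by apply: ae_bounded_sum => tau _; apply: ae_boundedZ; exact: bpw.
- apply: filterS (ae_Psi mPsi PPsi) => p pP _.
  by rewrite -mulr_sumr (pw_marginal hk wPsi PPsi hSYM Omega_gt0)// divff.
Qed.

Let edge_quad w := quad predT (fun i j a b => pairM P i j (psi w 0%N) a b)
  (fun j a => ctr (rho w j) a).

Let star_quad w := quad (fun l : 'I_g * 'I_k => l.2 != last) (star_ker hk P (psi w))
  (fun l a => ctr (rho w (k * l.1.+1 + l.2)%N) a).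

Let bpair := ae_bounded_pairM mPsi wPsi PPsi.
Let E_pair := Rintegral_pairM2 hk mPsi wPsi cPsi PPsi hSYM Omega_gt0.

Let bN_edge i j a b :
  ae_bounded (iid P g.+1) (fun t => pairM P i j (nth psi0 t 0) a b).
Proof. exact: (ae_bounded_nth psi0 _ (bpair i j a b)). Qed.

Lemma ae_bounded_edge_quad : ae_bounded W edge_quad.
Proof.
apply: (@ae_bounded_quad _ _ _ predT _ _ _ _ (iid P g.+1) pi rho0 (k * g.+1)
  (fun i j a b t => pairM P i j (nth psi0 t 0) a b) (fun a r => ctr r a) (fun j => j)).
- by move=> *; exact: bN_edge.
- exact: ae_bounded_ctr.
- by move=> j _; exact: pos0_lt.
Qed.

Let sum_energy : \sum_(ab : Omega * Omega) \sum_(ce : Omega * Omega)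
   q ^- 2 * Xi hk P (ab.1, ce.1) (ab.2, ce.2) *
     (cov (ab.1, ce.1) * cov (ab.2, ce.2)) = q ^- 2 * energy.
Proof.
rewrite (sum_pair_shuffle (fun a b c f =>
  q ^- 2 * Xi hk P (a, c) (b, f) * (cov (a, c) * cov (b, f)))).
rewrite /energy /inner mulr_sumr; apply: eq_bigr => -[u1 u2] _.
rewrite /Xi_op mulr_suml mulr_sumr; apply: eq_bigr => -[v1 v2] _ /=.
by move: (Xi _ _ _ _) => c; ring.
Qed.

Lemma Rintegral_edge_quad2 :
  \int[W]_w (edge_quad w ^+ 2) = 2^-1 * (k%:R * (k%:R - 1) * (q ^- 2 * energy)).
Proof.
rewrite (@Rintegral_quad2 _ _ _ predT _ _ _ _ (iid P g.+1) pi rho0 (k * g.+1)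
  (fun i j a b t => pairM P i j (nth psi0 t 0) a b) (fun a r => ctr r a) (fun j => j)).
- rewrite -sum_offdiag_ord; congr (_ * _); apply: eq_bigr => p /and3P[_ _ pp].
  rewrite -sum_energy; apply: eq_bigr => ab _; apply: eq_bigr => ce _.
  congr (_ * _); rewrite -(@E_pair p.1 p.2); last by rewrite eq_sym.
  apply: (@Rintegral_nth _ _ _ P psi0 g.+1 0%N (fun p0 =>
    pairM P p.1 p.2 p0 ab.1 ab.2 * pairM P p.1 p.2 p0 ce.1 ce.2)) => //.
  by apply: ae_boundedM; exact: bpair.
- by move=> *; exact: bN_edge.
- exact: ae_bounded_ctr.
- exact: Rintegral_ctr.
- by move=> j j' _ _ /val_inj.
- by move=> j _; exact: pos0_lt.
- by move=> l l' a b t; exact: pairM_sym.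
Qed.

Let N_star (l l' : 'I_g * 'I_k) a b (t : g.+1.-tuple weight) :=
  star_ker hk P (fun i => nth psi0 t i) l l' a b.

Let bN_star l l' a b : ae_bounded (iid P g.+1) (N_star l l' a b).
Proof.
have i_g (i : 'I_g) : (i < g.+1)%N by rewrite ltnS ltnW.
rewrite /N_star /star_ker; case: (l.1 == l'.1).
  exact: (ae_bounded_nth psi0 (i_g l.1) (bpair _ _ a b)).
apply: ae_bounded_sum => s _; apply: ae_boundedZ; apply: ae_boundedM;
  apply: ae_boundedZ.
- exact: (ae_bounded_nth psi0 (i_g l.1) (bpair _ _ s a)).
- exact: (ae_bounded_nth psi0 (i_g l'.1) (bpair _ _ s b)).
Qed.

Lemma ae_bounded_star_quad : ae_bounded W star_quad.
Proof.
apply: (@ae_bounded_quad _ _ _ (fun l : 'I_g * 'I_k => l.2 != last) _ _ _ _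
  (iid P g.+1) pi rho0 (k * g.+1) N_star (fun a r => ctr r a)
  (fun l => k * l.1.+1 + l.2)%N).
- by move=> *; exact: bN_star.
- exact: ae_bounded_ctr.
- by move=> l _; exact: pos_lt.
Qed.

Let sum_energy2 : \sum_(ab : Omega * Omega) \sum_(ce : Omega * Omega)
   (q ^- 2 * \sum_(s : Omega * Omega) Xi hk P s (ab.1, ce.1) * Xi hk P s (ab.2, ce.2)) *
     (cov (ab.1, ce.1) * cov (ab.2, ce.2)) = q ^- 2 * energy2.
Proof.
rewrite (sum_pair_shuffle (fun a b c f =>
  q ^- 2 * (\sum_(s : Omega * Omega) Xi hk P s (a, c) * Xi hk P s (b, f)) *
  (cov (a, c) * cov (b, f)))).
transitivity (q ^- 2 * \sum_u \sum_v \sum_s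
    (Xi hk P s u * cov u) * (Xi hk P s v * cov v)).
  rewrite mulr_sumr; apply: eq_bigr => -[u1 u2] _.
  rewrite mulr_sumr; apply: eq_bigr => -[v1 v2] _ /=.
  rewrite -mulrA; congr (_ * _); rewrite mulr_suml; apply: eq_bigr => s _.
  by rewrite mulrACA.
congr (_ * _); rewrite /energy2 /inner /Xi_op.
under eq_bigr do rewrite exchange_big /=.
rewrite exchange_big /=; apply: eq_bigr => s _.
by rewrite mulr_suml; apply: eq_bigr => u _; rewrite mulr_sumr.
Qed.

(** Within one clause, the expected squared kernel is an entry of [Xi], up to scaling. For different
    clauses, the square carries two root spins, and independence of the two weights gives a product
    of two entries of [Xi] with this pair as common first index; summing over the pair produces |Xi
    S|^2. *)
Lemma Rintegral_star_quad2 : \int[W]_w (star_quad w ^+ 2) = 2^-1 * (q ^- 2 *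
  (g%:R * (k%:R - 1) * (k%:R - 2) * energy +
   g%:R * (g%:R - 1) * (k%:R - 1) ^+ 2 * energy2)).
Proof.
have i_g (i : 'I_g) : (i < g.+1)%N by rewrite ltnS ltnW.
rewrite (@Rintegral_quad2 _ _ _ (fun l : 'I_g * 'I_k => l.2 != last) _ _ _ _
  (iid P g.+1) pi rho0 (k * g.+1) N_star (fun a r => ctr r a)
  (fun l => k * l.1.+1 + l.2)%N).
- congr (_ * _); transitivity (g%:R * (k%:R - 1) * (k%:R - 2) * (q ^- 2 * energy) +
    g%:R * (g%:R - 1) * (k%:R - 1) ^+ 2 * (q ^- 2 * energy2)); last by ring.
  rewrite -(sum_offdiag_star g last _ _ hk); apply: eq_bigr => p /and3P[p1 p2 pp].
  case: ifPn => ii.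
    rewrite -sum_energy; apply: eq_bigr => ab _; apply: eq_bigr => ce _.
    have jj : p.1.2 != p.2.2.
      by apply: contra pp => /eqP jj; rewrite -pair_eqE /pair_eq /= eq_sym ii jj eqxx.
    congr (_ * _); rewrite -(E_pair _ _ _ _ jj) /N_star /star_ker ii.
    apply: (@Rintegral_nth _ _ _ P psi0 g.+1 p.1.1 (fun p0 =>
      pairM P p.1.2 p.2.2 p0 ab.1 ab.2 * pairM P p.1.2 p.2.2 p0 ce.1 ce.2)) => //.
    by apply: ae_boundedM; exact: bpair.
  rewrite -sum_energy2; apply: eq_bigr => ab _; apply: eq_bigr => ce _.
  congr (_ * _); rewrite /N_star /star_ker (negbTE ii).
  pose f (m : 'I_k) s a s' c p0 := pairM P last m p0 s a * pairM P last m p0 s' c.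
  have bf m s a s' c : ae_bounded P (f m s a s' c) by apply: ae_boundedM; exact: bpair.
  pose h (s : Omega * Omega) (t : g.+1.-tuple weight) :=
    f p.1.2 s.1 ab.1 s.2 ce.1 (nth psi0 t p.1.1) *
    f p.2.2 s.1 ab.2 s.2 ce.2 (nth psi0 t p.2.1).
  (* The factor [q ^+ 2] is the square of the prefactor [q^-1 * q * q] of [star_ker]. *)
  transitivity (\int[iid P g.+1]_t (q ^+ 2 * \sum_(s : Omega * Omega) h s t)).
    apply: eq_Rintegral => t _; rewrite mulr_suml.
    rewrite -(pair_bigA _ (fun s s' => h (s, s') t)) /= mulr_sumr.
    apply: eq_bigr => s _; rewrite [LHS]mulr_sumr [RHS]mulr_sumr.
    by apply: eq_bigr => s' _; rewrite /h /f /=; field.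
  have bh s : ae_bounded (iid P g.+1) (h s).
    apply: ae_boundedM.
      exact: (ae_bounded_nth psi0 (i_g p.1.1) (bf p.1.2 s.1 ab.1 s.2 ce.1)).
    exact: (ae_bounded_nth psi0 (i_g p.2.1) (bf p.2.2 s.1 ab.2 s.2 ce.2)).
  rewrite RintegralZ_bounded; last by apply: ae_bounded_sum => s _; exact: bh.
  rewrite Rintegral_sum; last by move=> s _; exact: bh.
  rewrite !mulr_sumr; apply: eq_bigr => -[s s'] _.
  rewrite /h (@Rintegral_iid2 _ _ _ P psi0 g.+1 p.1.1 p.2.1 (f p.1.2 s ab.1 s' ce.1)
    (f p.2.2 s ab.2 s' ce.2))// /f !E_pair; try by rewrite eq_sym.
  by move: (Xi _ _ _ _) (Xi _ _ _ _) => c c'; field.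
- by move=> *; exact: bN_star.
- exact: ae_bounded_ctr.
- exact: Rintegral_ctr.
- by move=> [i j] [i' j'] _ _ /= /pos_inj[/val_inj -> ->].
- by move=> l _; exact: pos_lt.
- move=> l l' a b t; rewrite /N_star /star_ker eq_sym; case: eqP => [->|_].
    exact: pairM_sym.
  by apply: eq_bigr => s _; congr (_ * _); exact: mulrC.
Qed.

Let ctr_ge (r : euclidean R Omega) a : near_uniform e r -> 0 <= 1 + ctr r a.
Proof.
move=> [/(_ a) /ler_normlP[h _] _]; case/andP: e01 => _ e1.
by move: h; lra.
Qed.

Let pw_ge0' p tau : Psi p -> 0 <= pw P p tau.
Proof. exact: (pw_ge0 hk wPsi PPsi hSYM Omega_gt0). Qed.

(* With [kap] false only convexity of x ln x is used, so that [e] need not be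
   small compared to [g]. *)
Lemma bethe_inner_ge (d : R) (kap : bool) : 0 <= d ->
  4 * @edge_const R k * e ^+ 2 <= 1 -> (kap -> 4 * @star_const R k g * e ^+ 2 <= 1) ->
  ((ln q + g%:R * ln (xi P) + kap%:R * (4^-1 * (q ^- 2 *
      (g%:R * (k%:R - 1) * (k%:R - 2) * energy +
       g%:R * (g%:R - 1) * (k%:R - 1) ^+ 2 * energy2)) -
     entropy_const (@star_const R k g) * e ^+ 5) -
    d * (k%:R - 1) / k%:R * (ln (xi P) +
      4^-1 * (k%:R * (k%:R - 1) * (q ^- 2 * energy)) +
      entropy_const (@edge_const R k) * e ^+ 5))%:E <=
   \int[W]_w (bethe_integrand hk P d g w.1 w.2)%:E)%E.
Proof.
move=> d0 he hs; have xi_pos := xi_gt0 hk wPsi PPsi hSYM Omega_gt0.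
have q_pos := @q_gt0 R _ Omega_gt0.
have Ce0 := @edge_const_ge0 R k.
have Cs0 : 0 <= @star_const R k g by exact: jet_const_ge0.
have k1 : 1 <= (k%:R : R) by rewrite ler1n ltnW.
set D := d * (k%:R - 1) / k%:R.
have D0 : 0 <= D by rewrite /D divr_ge0 ?mulr_ge0 ?subr_ge0// ler0n.
set cs := entropy_const _ * e ^+ 5; set ce := entropy_const _ * e ^+ 5.
set lq := ln q + g%:R * ln (xi P).
(* A minorant with explicit expectation: [star] and [edge] have mean 1, and the second moments of
   the quadratic parts are known. Its coefficients come from [Lambda_scale] followed by the bounds
   on [Lambda]. *)
pose LB w := (lq + 1) * star w + (kap%:R / 2) * star_quad w ^+ 2 +
  (- D * (ln (xi P) + 1)) * edge w + (- D / 2) * edge_quad w ^+ 2 +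
  (- 1 - kap%:R * cs + D - D * ce).
have b1 : ae_bounded W (fun w => (lq + 1) * star w).
  by apply: ae_boundedZ; exact: ae_bounded_star.
have b2 : ae_bounded W (fun w => (kap%:R / 2) * star_quad w ^+ 2).
  by apply: ae_boundedZ; apply: ae_boundedX; exact: ae_bounded_star_quad.
have b3 : ae_bounded W (fun w => (- D * (ln (xi P) + 1)) * edge w).
  by apply: ae_boundedZ; exact: ae_bounded_edge.
have b4 : ae_bounded W (fun w => (- D / 2) * edge_quad w ^+ 2).
  by apply: ae_boundedZ; apply: ae_boundedX; exact: ae_bounded_edge_quad.
have b12 := ae_boundedD b1 b2; have b123 := ae_boundedD b12 b3.
have b1234 := ae_boundedD b123 b4.
have b5 := ae_bounded_cst W (- 1 - kap%:R * cs + D - D * ce).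
have bLB : ae_bounded W LB := ae_boundedD b1234 b5.
have ELB : \int[W]_w LB w = lq + kap%:R * (4^-1 * (q ^- 2 *
      (g%:R * (k%:R - 1) * (k%:R - 2) * energy +
       g%:R * (g%:R - 1) * (k%:R - 1) ^+ 2 * energy2)) - cs) -
    D * (ln (xi P) + 4^-1 * (k%:R * (k%:R - 1) * (q ^- 2 * energy)) + ce).
  rewrite (RintegralD_bounded b1234 b5) (RintegralD_bounded b123 b4).
  rewrite (RintegralD_bounded b12 b3) (RintegralD_bounded b1 b2) Rintegral_cst1.
  rewrite (RintegralZ_bounded _ ae_bounded_star) (RintegralZ_bounded _ ae_bounded_edge).
  rewrite (RintegralZ_bounded _ (ae_boundedX 2 ae_bounded_star_quad)).
  rewrite (RintegralZ_bounded _ (ae_boundedX 2 ae_bounded_edge_quad)).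
  rewrite Rintegral_star Rintegral_edge Rintegral_star_quad2 Rintegral_edge_quad2.
  by move: energy energy2 (q ^- 2) (ln (xi P)) => E1 E2 qq lx; field.
rewrite -ELB; apply: Rintegral_le_integral => //.
  have ms := ae_bounded_measurable ae_bounded_star.
  have me := ae_bounded_measurable ae_bounded_edge.
  have mb := measurable_LambdaB (q * xi P ^+ g)^-1 (q * xi P ^+ g)
    D (xi P)^-1 (xi P) ms me.
  by move: mb; congr measurable_fun; apply/funext => w; rewrite bethe_integrandE.
apply: filterS ae_good => w [hpsi hrho].
have Psi0 : Psi (psi w 0) by exact: hpsi.
have edge0 : 0 <= edge w.
  apply: sumr_ge0 => tau _; rewrite mulr_ge0 ?pw_ge0'//.
  by apply: prodr_ge0 => j _; apply: ctr_ge; exact: hrho.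
have star0 : 0 <= star w.
  apply: sumr_ge0 => s _; rewrite mulr_ge0 ?invr_ge0 ?ler0n//.
  apply: prodr_ge0 => i _; apply: sumr_ge0 => tau _.
  have Pi : Psi (psi w i) by apply: hpsi; rewrite ltnS ltnW.
  apply: mulr_ge0; first by apply: mulr_ge0; [rewrite ler0n|exact: pw_ge0'].
  by apply: prodr_ge0 => j _; apply: ctr_ge; apply: hrho; exact: pos_lt.
have jedge : jet e (@edge_const R k) (edge w) 0 (edge_quad w).
  apply: (jet_edge hk wPsi PPsi hSYM Omega_gt0 e01 Psi0) => j.
  by apply: hrho; exact: pos0_lt.
have jstar : jet e (@star_const R k g) (star w) 0 (star_quad w).
  apply: (jet_star wPsi PPsi hSYM Omega_gt0 e01) => [i i_g|i j i_g _].
    by apply: hpsi; rewrite ltnS ltnW.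
  by apply: hrho; exact: pos_lt.
have /ler_normlP[_ Ledge] := entropy_jet e01 Ce0 he jedge.
have Lstar : star w - 1 + kap%:R * (star_quad w ^+ 2 / 2 - cs) <= Lambda (star w).
  case: kap hs {LB b2 b12 b123 b1234 b5 bLB ELB} => [/(_ isT) hs|_]; last first.
    by rewrite mul0r addr0; exact: Lambda_ge.
  have /ler_normlP[+ _] := entropy_jet e01 Cs0 hs jstar.
  by rewrite mul1r -/cs; lra.
rewrite bethe_integrandE Lambda_scale ?mulr_gt0 ?exprn_gt0// -/(star w).
rewrite Lambda_scale// -/(edge w) -/D lnM ?posrE ?exprn_gt0// lnXn//.
rewrite -[ln (xi P) *+ g]mulr_natl -/lq.
have : D * (edge w * ln (xi P) + Lambda (edge w)) <= D * (edge w * ln (xi P) +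
    (edge w - 1 + edge_quad w ^+ 2 / 2 + ce)).
  by apply: ler_wpM2l => //; rewrite lerD2l -/ce in Ledge *; lra.
rewrite /LB; move: Lstar.
move: (star w) (edge w) (star_quad w ^+ 2) (edge_quad w ^+ 2) => y1 y2 y3 y4.
move: (Lambda y1) (Lambda y2) (ln (xi P)) => L1 L2 lx h1 h2.
apply: le_trans (lerB (lerD (lexx (y1 * lq)) h1) h2).
by rewrite le_eqVlt; apply/orP; left; apply/eqP; field.
Qed.

End fixed_degree.
End bethe_expansion.

(** * Poisson averages *)

Section poisson_moments.
Context {R : realType} (r : R) (r0 : 0 < r).
Local Notation Po := (poisson_prob r 0).
Local Notation pmf := (poisson_pmf r).

Lemma poisson_prob1 i : Po [set i] = (pmf i)%:E.
Proof. by rewrite /poisson_prob r0 esum_set1// lee_fin poisson_pmf_ge0. Qed.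

Lemma ge0_integral_poisson (f : nat -> \bar R) : (forall i, (0 <= f i)%E) ->
  (\int[Po]_i f i = \sum_(0 <= i <oo) f i * (pmf i)%:E)%E.
Proof.
move=> f0; have -> : [set: nat] = \bigcup_i [set i] :> set nat.
  by apply/seteqP; split => // i _; exists i.
rewrite ge0_integral_bigcup//; last first.
  by apply/trivIsetP => i j _ _ /eqP ij; apply/seteqP; split => // x [-> /ij].
apply: eq_eseriesr => i _; rewrite -poisson_prob1.
rewrite (_ : (\int[Po]_(x in [set i]) f x = \int[Po]_(x in [set i]) cst (f i) x)%E).
  by rewrite integral_cst.
by apply: eq_integral => x; rewrite inE /= => ->.
Qed.

Lemma poisson_pmfS i : i.+1%:R * pmf i.+1 = r * pmf i.
Proof.
rewrite /poisson_pmf r0 exprS factS natrM invfM.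
have : i.+1%:R != 0 :> R by rewrite pnatr_eq0.
by move: (i.+1%:R : R) (i`!%:R^-1 : R) => a b a0; field.
Qed.

Lemma poisson_mean : (\int[Po]_i (i%:R)%:E = r%:E)%E.
Proof.
rewrite ge0_integral_poisson => [|i]; last by rewrite lee_fin.
have nn i : (0 <= i%:R%:E * (pmf i)%:E)%E.
  by rewrite mule_ge0 ?lee_fin ?poisson_pmf_ge0.
rewrite nneseries_recl// mul0e add0e -nneseries_addn//.
under eq_eseriesr do rewrite addn1 -EFinM poisson_pmfS EFinM.
rewrite nneseriesZl => [|i _]; last by rewrite lee_fin poisson_pmf_ge0.
have : (\int[Po]_i (cst 1 i) = 1)%E.
  by rewrite integral_cst// mul1e; exact: (@probability_setT _ _ _ Po).
rewrite ge0_integral_poisson//.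
by under eq_eseriesr do rewrite mul1e; move=> ->; rewrite mule1.
Qed.

Lemma poisson_pmf_sum_gt (t : R) : t < 1 -> exists n, t < \sum_(i < n) pmf i.
Proof.
move=> t1; have cv : series (exp_coeff r) @ \oo --> expR r.
  exact: is_cvg_series_exp_coeff.
have te : t * expR r < expR r by rewrite gtr_pMl ?expR_gt0.
have [n _ hn] := cvgr_gt _ cv _ te.
exists n; have := hn n (leqnn n).
rewrite -ltr_pdivlMr ?expR_gt0// => /lt_le_trans; apply.
rewrite /series /= big_mkord mulr_suml; apply: ler_sum => i _.
by rewrite /poisson_pmf r0 /exp_coeff /= expRN.
Qed.

(** By [poisson_pmfS] the two factorial moments shift the index by one and by two. Truncated below n
    + 2, they are r times the mass below n + 1 and r^2 times the mass below n. *)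
Lemma poisson_factorial_moments n (al be : R) : 0 <= al -> 0 <= be ->
  (al * r + be * r ^+ 2) * \sum_(i < n) pmf i <=
  \sum_(i < n.+2) pmf i * (i%:R * al + i%:R * (i%:R - 1) * be).
Proof.
move=> al0 be0.
have m1 m : \sum_(i < m.+1) pmf i * i%:R = r * \sum_(i < m) pmf i.
  rewrite big_ord_recl mulr0 add0r mulr_sumr; apply: eq_bigr => i _.
  by rewrite mulrC /= poisson_pmfS.
have m2 m : \sum_(i < m.+2) pmf i * (i%:R * (i%:R - 1)) = r ^+ 2 * \sum_(i < m) pmf i.
  rewrite big_ord_recl mul0r mulr0 add0r expr2 -mulrA -m1 mulr_sumr.
  apply: eq_bigr => i _ /=; rewrite -natr1 addrK natr1 mulrCA mulrA (mulrC (pmf _)).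
  by rewrite poisson_pmfS; ring.
have -> : \sum_(i < n.+2) pmf i * (i%:R * al + i%:R * (i%:R - 1) * be) =
    al * \sum_(i < n.+2) pmf i * i%:R + be * \sum_(i < n.+2) pmf i * (i%:R * (i%:R - 1)).
  by rewrite !mulr_sumr -big_split /=; apply: eq_bigr => i _; ring.
rewrite m1 m2 mulrDl -!mulrA lerD2r; apply: ler_wpM2l => //.
apply: ler_wpM2l; first exact: ltW.
by rewrite big_ord_recr /= lerDl poisson_pmf_ge0.
Qed.

(** Beyond the cutoff a bound affine in the degree suffices, since the Poisson mean is [r]. For the
    Bethe functional [c1] is [ln (xi P)], and [h] holds the second-order gain of the star. *)
Lemma poisson_integral_ge (f : nat -> \bar R) (c0 c1 : R) (h : nat -> R) n :
  (forall i, ((c0 + i%:R * c1 + (if (i < n)%N then h i else 0))%:E <= f i)%E) ->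
  ((c0 + r * c1 + \sum_(i < n) pmf i * h i)%:E <= \int[Po]_i f i)%E.
Proof.
move=> hf; pose L i := c0 + i%:R * c1 + (if (i < n)%N then h i else 0).
have bi (i : nat) : ae_bounded Po (fun j : nat => (j == i)%:R : R).
  split => //; exists 1; apply: aeW => j.
  by case: (j == i); rewrite ?normr1 ?normr0.
have bh : ae_bounded Po (fun i => if (i < n)%N then h i else 0 : R).
  have := @ae_bounded_sum _ _ _ Po _ (index_enum 'I_n) predT
    (fun i j => h i * (j == i :> nat)%:R) (fun i _ => ae_boundedZ (h i) (bi i)).
  congr ae_bounded; apply/funext => j; case: ifP => jn.
    rewrite (bigD1 (Ordinal jn))//= eqxx mulr1 big1 ?addr0// => i.
    by rewrite -val_eqE /= eq_sym => /negbTE->; rewrite mulr0.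
  rewrite big1// => i _; case: eqP => [ji|]; last by rewrite mulr0.
  by move: jn; rewrite ji ltn_ord.
have Eh : \int[Po]_i (if (i < n)%N then h i else 0 : R) = \sum_(i < n) pmf i * h i.
  transitivity (\int[Po]_j (\sum_(i < n) h i * (j == i :> nat)%:R)).
    apply: eq_Rintegral => j _; case: ifP => jn.
      rewrite (bigD1 (Ordinal jn))//= eqxx mulr1 big1 ?addr0// => i.
      by rewrite -val_eqE /= eq_sym => /negbTE->; rewrite mulr0.
    rewrite big1// => i _; case: eqP => [ji|]; last by rewrite mulr0.
    by move: jn; rewrite ji ltn_ord.
  rewrite Rintegral_sum => [|i _]; last exact: ae_boundedZ.
  apply: eq_bigr => i _; rewrite RintegralZ_bounded// mulrC; congr (_ * _).
  rewrite /Rintegral (_ : (fun j => _) = (EFin \o \1_[set (i : nat)])); last first.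
    apply/funext => j /=; rewrite indicE; congr (_%:R%:E); congr nat_of_bool.
    by apply/eqP/idP => [->|/set_mem]; rewrite ?inE.
  by rewrite integral_indic// setIT; exact: (congr1 fine (poisson_prob1 i)).
have im : Po.-integrable setT (fun i => (i%:R : R)%:E).
  apply/integrableP; split => //; under eq_integral => i _.
    by rewrite gee0_abs ?lee_fin//; over.
  by rewrite poisson_mean ltry.
have icst : Po.-integrable setT (EFin \o (fun=> c0)).
  by apply: ae_bounded_integrable; exact: ae_bounded_cst.
have ic1 : Po.-integrable setT (EFin \o (fun i : nat => i%:R * c1)).
  rewrite (_ : _ \o _ = fun i : nat => (c1%:E * (i%:R : R)%:E)%E).
    exact: integrableZl.
  by apply/funext => i /=; rewrite mulrC EFinM.
have ih := ae_bounded_integrable bh.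
have -> : (c0 + r * c1 + \sum_(i < n) pmf i * h i)%:E = (\int[Po]_i (L i)%:E)%E.
  have ic01 : Po.-integrable setT (EFin \o (fun i : nat => c0 + i%:R * c1)).
    exact: integrableD icst ic1.
  rewrite -[RHS]fineK; last first.
    by apply: integrable_fin_num => //; exact: integrableD ic01 ih.
  congr EFin; rewrite -[RHS]/(\int[Po]_i L i) /L (RintegralD _ ic01 ih)//.
  rewrite (RintegralD _ icst ic1)// Eh Rintegral_cst1; congr (_ + _ + _).
  rewrite RintegralZr//; congr (_ * _).
  by rewrite /Rintegral poisson_mean.
apply: le_integral_ae => //.
by apply: aeW.
Qed.

End poisson_moments.

(** * Uniform laws on finitely many points *)

Section empirical.
Context {d : measure_display} {T : measurableType d} {R : realType}.
Variables (n : nat) (x : nat -> T).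

Let weight : {nonneg R} := (n.+1%:R^-1)%:nng.

(** There are [n.+1] atoms, counted with multiplicity, so the list is never empty. *)
Definition empirical : set T -> \bar R := mscale weight (msum (fun i => \d_(x i)) n.+1).

HB.instance Definition _ := Measure.on empirical.

Lemma empirical1 (D : set T) : (forall i, (i < n.+1)%N -> D (x i)) -> empirical D = 1%E.
Proof.
move=> Dx; rewrite /empirical /mscale /= /msum.
rewrite (eq_bigr (fun=> 1%E)) => [|i _]; last first.
  by rewrite /= /dirac indicE mem_set//; exact: Dx.
rewrite sumEFin sumr_const card_ord -EFinM; congr EFin.
by rewrite -[1 *+ _]/(n.+1%:R) mulVf// pnatr_eq0.
Qed.

HB.instance Definition _ := Measure_isProbability.Build _ _ R empirical
  (empirical1 (fun i _ => I)).

Lemma Rintegral_empirical (f : T -> R) : measurable_fun setT f ->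
  \int[empirical]_t f t = n.+1%:R^-1 * \sum_(i < n.+1) f (x i).
Proof.
move=> mf.
have ge0 (h : T -> \bar R) : measurable_fun setT h -> (forall t, 0 <= h t)%E ->
    (\int[empirical]_t h t = (n.+1%:R^-1)%:E * \sum_(i < n.+1) h (x i))%E.
  move=> mh h0; rewrite ge0_integral_mscale// ge0_integral_measure_sum//.
  congr (_ * _)%E; apply: eq_bigr => i _.
  by rewrite integral_dirac// diracT mul1e.
rewrite /Rintegral integralE.
rewrite !ge0//; try (exact: measurable_funepos (measurableT_comp _ _) ||
   exact: measurable_funeneg (measurableT_comp _ _)).
- rewrite (eq_bigr (fun i : 'I_n.+1 => (Num.max (f (x i)) 0)%:E)) => [|i _]; last first.
    by rewrite funeposE EFin_max.
  rewrite [X in (_ - _ * X)%E](eq_bigr (fun i : 'I_n.+1 =>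
    (Num.max (- f (x i)) 0)%:E)) => [|i _]; last first.
    by rewrite funenegE EFin_max.
  rewrite !sumEFin -!EFinM -EFinB /= -mulrBr -sumrB; congr (_ * _).
  apply: eq_bigr => i _; have [h|h] := leP 0 (f (x i)).
    by rewrite max_r ?oppr_le0// subr0.
  by rewrite max_l ?oppr_ge0 ?ltW// sub0r opprK.
Qed.

End empirical.

(** * Balanced factorization on pairs of spins *)

Section factorization.
Context {R : realType} {Omega : finType}.

(** Transfers [polar_factor] along an enumeration of [Omega]. Vanishing row and column sums place
    the all-ones vector in both kernels of [X], and the factors inherit this; perturbations of the
    uniform distribution along them keep total mass 1. *)
Lemma balanced_factorization (X : Omega * Omega -> R) :
  (forall b, \sum_a X (a, b) = 0) -> (forall a, \sum_b X (a, b) = 0) ->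
  exists m (u v : 'I_m.+1 -> Omega -> R),
  [/\ forall a b, X (a, b) = \sum_i u i a * v i b,
      (forall i, \sum_a u i a = 0) /\ (forall i, \sum_b v i b = 0),
      \sum_(p : Omega * Omega) (\sum_i u i p.1 * u i p.2) ^+ 2 = \sum_p X p ^+ 2 &
      \sum_(p : Omega * Omega) (\sum_i v i p.1 * v i p.2) ^+ 2 = \sum_p X p ^+ 2].
Proof.
move=> X1 X2; case: (posnP #|Omega|) => [card0|].
  have noO (a : Omega) : False by have := fintype0 a card0.
  exists 0%N, (fun _ _ => 0), (fun _ _ => 0); split.
  - by move=> a; case: (noO a).
  - by split=> i; rewrite big1.
  - by apply: eq_bigr => -[a]; case: (noO a).
  - by apply: eq_bigr => -[a]; case: (noO a).
move=> /prednK; set m := #|Omega|.-1 => Om.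
pose ev (i : 'I_m.+1) : Omega := enum_val (cast_ord Om i).
pose er (a : Omega) : 'I_m.+1 := cast_ord (esym Om) (enum_rank a).
have erK : cancel er ev by move=> a; rewrite /ev /er cast_ordKV enum_rankK.
have evK : cancel ev er by move=> i; rewrite /ev /er enum_valK cast_ordK.
have sumE (F : Omega -> R) : \sum_a F a = \sum_i F (ev i).
  by rewrite (reindex ev)//; exists er => i _; [exact: evK|exact: erK].
have sum2E (F : Omega -> Omega -> R) :
    \sum_(p : Omega * Omega) F p.1 p.2 = \sum_i \sum_j F (ev i) (ev j).
  by rewrite -pair_bigA sumE; apply: eq_bigr => i _; rewrite sumE.
pose M : 'M[R]_m.+1 := \matrix_(i, j) X (ev i, ev j).
have [U [V [MUV trU trV MU MV]]] := polar_factor M.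
have trE (A B : 'M[R]_m.+1) : A = B^T -> \tr (A *m B) = \sum_i \sum_j A i j ^+ 2.
  move=> AB; rewrite /mxtrace; apply: eq_bigr => i _; rewrite mxE.
  by apply: eq_bigr => j _; rewrite AB mxE expr2.
have sumX : \sum_p X p ^+ 2 = \tr (M *m M^T).
  rewrite trE ?trmxK//.
  transitivity (\sum_(p : Omega * Omega) X (p.1, p.2) ^+ 2).
    by apply: eq_bigr => -[].
  rewrite (sum2E (fun a b => X (a, b) ^+ 2)).
  by apply: eq_bigr => i _; apply: eq_bigr => j _; rewrite mxE.
have gram (A : 'M[R]_m.+1) : \tr (A *m A^T *m (A *m A^T)) = \tr (M *m M^T) ->
    \sum_(p : Omega * Omega) (\sum_i A (er p.1) i * A (er p.2) i) ^+ 2 =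
    \sum_p X p ^+ 2.
  rewrite sumX => <-; rewrite trE; last by rewrite trmx_mul trmxK.
  rewrite (sum2E (fun a b => (\sum_i A (er a) i * A (er b) i) ^+ 2)).
  apply: eq_bigr => i _; apply: eq_bigr => j _; rewrite !evK mxE; congr (_ ^+ 2).
  by apply: eq_bigr => l _; rewrite mxE.
exists m, (fun i a => U (er a) i), (fun i b => V (er b) i); split.
- move=> a b; have := congr1 (fun A : 'M[R]_m.+1 => A (er a) (er b)) MUV.
  rewrite !mxE !erK => ->; apply: eq_bigr => i _; by rewrite mxE.
- split=> i.
    have /matrixP/(_ 0 i) : (const_mx 1 : 'rV[R]_m.+1) *m U = 0.
      apply: MU; apply/matrixP => l j; rewrite !mxE.
      under eq_bigr do rewrite !mxE mul1r.
      by rewrite -(sumE (fun a => X (a, ev j))) X1.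
    rewrite !mxE => h; rewrite -[RHS]h sumE; apply: eq_bigr => j _.
    by rewrite mxE mul1r evK.
  have /matrixP/(_ i 0) : V^T *m (const_mx 1 : 'cV[R]_m.+1) = 0.
    apply: MV; apply/matrixP => j l; rewrite !mxE.
    under eq_bigr do rewrite !mxE mulr1.
    by rewrite -(sumE (fun b => X (ev j, b))) X2.
  rewrite !mxE => h; rewrite -[RHS]h sumE; apply: eq_bigr => j _.
  by rewrite !mxE mulr1 evK.
- exact: gram.
- exact: gram.
Qed.

End factorization.

(** * The Kesten-Stigum maximum *)

Section kesten_stigum.
Context {R : realType} {Omega : finType} {k : nat} (hk : (2 <= k)%N).
Local Notation q := (#|Omega|%:R : R).
Local Notation config := {ffun 'I_k -> Omega}.
Local Notation weight := (euclidean R config).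
Variables (Psi : set weight) (P : probability weight R).
Hypotheses (mPsi : measurable Psi) (wPsi : forall psi, Psi psi -> is_weight psi).
Hypotheses (PPsi : P Psi = 1%E).

(** The sum of the tensors u_i (x) v_i. For u = v it is positive semidefinite and, up to scaling,
    the covariance of [perturbed_law]. *)
Definition gram m (u v : 'I_m -> Omega -> R) (p : Omega * Omega) : R :=
  \sum_i u i p.1 * v i p.2.

(** The number <u_i, Phi u_j>. *)
Let form m (u : 'I_m -> Omega -> R) i j psi : R :=
  \sum_(ab : Omega * Omega) Phi hk P psi ab.1 ab.2 * (u i ab.1 * u j ab.2).

Let bPhi a b : ae_bounded P (fun psi => Phi hk P psi a b).
Proof.
apply: ae_boundedZ; apply: ae_bounded_sum => tau _.
exact: (ae_bounded_eval mPsi wPsi PPsi).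
Qed.

Let bform m u i j : ae_bounded P (@form m u i j).
Proof.
apply: ae_bounded_sum => ab _; apply: ae_boundedM; first exact: bPhi.
exact: ae_bounded_cst.
Qed.

Let Xi_gram m (u v : 'I_m -> Omega -> R) :
  inner (Xi_op hk P (gram u v)) (gram u v) =
  \int[P]_psi (\sum_i \sum_j form u i j psi * form v i j psi).
Proof.
pose F psi (p r : Omega * Omega) := Phi hk P psi p.1 r.1 * Phi hk P psi p.2 r.2.
have bF p r : ae_bounded P (fun psi => F psi p r) by apply: ae_boundedM; exact: bPhi.
transitivity (\int[P]_psi (\sum_p \sum_r (gram u v r * gram u v p) * F psi p r)).
  rewrite Rintegral_sum; last first.
    by move=> p _; apply: ae_bounded_sum => r _; exact: ae_boundedZ.
  rewrite /inner; apply: eq_bigr => p _; rewrite Rintegral_sum; last first.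
    by move=> r _; exact: ae_boundedZ.
  rewrite /Xi_op mulr_suml; apply: eq_bigr => r _.
  by rewrite RintegralZ_bounded// /Xi /tensor_mx -/(F _ _ _) [RHS]mulrC mulrA.
apply: eq_Rintegral => psi _.
transitivity (\sum_p \sum_r \sum_i \sum_j
  (Phi hk P psi p.1 r.1 * (u i p.1 * u j r.1)) *
  (Phi hk P psi p.2 r.2 * (v i p.2 * v j r.2))).
  apply: eq_bigr => p _; apply: eq_bigr => r _.
  rewrite [gram u v r * _]mulrC /gram !mulr_suml; apply: eq_bigr => i _.
  rewrite mulr_sumr mulr_suml; apply: eq_bigr => j _; rewrite /F; ring.
rewrite -(sum_pair_shuffle (fun a b c e => \sum_i \sum_j
  (Phi hk P psi a b * (u i a * u j b)) * (Phi hk P psi c e * (v i c * v j e)))).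
under eq_bigr do rewrite exchange_big /=.
rewrite exchange_big /=; apply: eq_bigr => i _.
under eq_bigr do rewrite exchange_big /=.
rewrite exchange_big /=; apply: eq_bigr => j _.
by rewrite /form mulr_suml; apply: eq_bigr => ab _; rewrite mulr_sumr.
Qed.

Lemma Xi_gram_ge0 m (u : 'I_m -> Omega -> R) :
  0 <= inner (Xi_op hk P (gram u u)) (gram u u).
Proof.
rewrite Xi_gram; apply: Rintegral_ge0 => psi _.
by apply: sumr_ge0 => i _; apply: sumr_ge0 => j _; rewrite -expr2 sqr_ge0.
Qed.

(** Termwise 2 x y <= x^2 + y^2 under the expectation, with x = <u_i, Phi u_j> and y = <v_i, Phi
    v_j>. This uses that [Xi] is an average of tensor squares. *)
Lemma Xi_gram_le m (u v : 'I_m -> Omega -> R) :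
  inner (Xi_op hk P (gram u v)) (gram u v) <=
  2^-1 * (inner (Xi_op hk P (gram u u)) (gram u u) +
          inner (Xi_op hk P (gram v v)) (gram v v)).
Proof.
rewrite !Xi_gram.
have bb (u' v' : 'I_m -> Omega -> R) :
    ae_bounded P (fun psi => \sum_i \sum_j form u' i j psi * form v' i j psi).
  apply: ae_bounded_sum => i _; apply: ae_bounded_sum => j _.
  by apply: ae_boundedM; exact: bform.
rewrite -RintegralD_bounded// -RintegralZ_bounded; last exact: ae_boundedD.
apply: le_Rintegral => //.
- exact: ae_bounded_integrable.
- by apply: ae_bounded_integrable; apply: ae_boundedZ; exact: ae_boundedD.
move=> psi _; rewrite -big_split /= mulr_sumr; apply: ler_sum => i _.
rewrite -big_split /= mulr_sumr; apply: ler_sum => j _.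
have := sqr_ge0 (form u i j psi - form v i j psi); rewrite !expr2; nra.
Qed.

Lemma innerE (x y : Omega * Omega -> R) :
  inner x y = \sum_a \sum_b x (a, b) * y (a, b).
Proof. by rewrite [RHS]pair_bigA; apply: eq_bigr => -[]. Qed.

Lemma Espace_marginals (x : Omega * Omega -> R) : Espace x ->
  (forall b, \sum_a x (a, b) = 0) /\ (forall a, \sum_b x (a, b) = 0).
Proof.
move=> Ex; split=> c; have [h1 h2] := Ex (fun a => (a == c)%:R).
  rewrite -[RHS]h1 innerE; apply: eq_bigr => a _.
  rewrite (bigD1 c)//= /tensor_vec /= eqxx !mulr1 big1 ?addr0//.
  by move=> b /negbTE->; rewrite !mulr0.
rewrite -[RHS]h2 innerE exchange_big; apply: eq_bigr => b _.
rewrite (bigD1 c)//= /tensor_vec /= eqxx !mulr1 big1 ?addr0//.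
by move=> a /negbTE->; rewrite mul0r mulr0.
Qed.

Lemma gram_Espace m (u : 'I_m -> Omega -> R) :
  (forall i, \sum_a u i a = 0) -> Espace (gram u u).
Proof.
move=> u0 y; split; rewrite innerE.
  rewrite exchange_big big1//= => b _.
  rewrite /tensor_vec /=; under eq_bigr do rewrite mul1r /gram /= mulr_suml.
  rewrite exchange_big big1//= => i _.
  under eq_bigr do rewrite -mulrA; by rewrite -mulr_suml u0 mul0r.
rewrite big1//= => a _.
rewrite /tensor_vec /=; under eq_bigr do rewrite mulr1 /gram /= mulr_suml.
rewrite exchange_big big1//= => i _.
under eq_bigr do rewrite mulrAC; by rewrite -mulr_sumr u0 mulr0.
Qed.

Lemma norm2_eq1 (x : Omega * Omega -> R) : norm2 x = 1 <-> \sum_p x p ^+ 2 = 1.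
Proof.
have xx : inner x x = \sum_p x p ^+ 2 by apply: eq_bigr => p _; rewrite expr2.
have x0 : 0 <= \sum_p x p ^+ 2 by apply: sumr_ge0 => p _; rewrite sqr_ge0.
rewrite /norm2 xx; split=> [h|->]; last by rewrite sqrtr1.
by rewrite -(sqr_sqrtr x0) h expr1n.
Qed.

(** The larger of the two Gram values dominates their mean, hence the value at [x]; the balanced
    norms keep that Gram matrix on the unit sphere. *)
Lemma gram_improve (x : Omega * Omega -> R) : Espace x -> norm2 x = 1 ->
  exists m (w : 'I_m.+1 -> Omega -> R), [/\ forall i, \sum_a w i a = 0,
    \sum_p gram w w p ^+ 2 = 1 &
    inner (Xi_op hk P x) x <= inner (Xi_op hk P (gram w w)) (gram w w)].
Proof.
move=> /Espace_marginals[x1 x2] /norm2_eq1 xn.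
have [m [u [v [xE [u0 v0] nu nv]]]] := balanced_factorization x1 x2.
have -> : x = gram u v by apply/funext => -[a b]; rewrite xE.
have := Xi_gram_le u v.
have [uv|uv] := leP (inner (Xi_op hk P (gram u u)) (gram u u))
  (inner (Xi_op hk P (gram v v)) (gram v v)) => h.
  exists m, v; split => //; first by rewrite nv.
  by apply: le_trans h _; lra.
exists m, u; split => //; first by rewrite nu.
by apply: le_trans h _; lra.
Qed.

Lemma KS_max_witness : KS_max hk P != 0 -> 0 < KS_max hk P /\
  forall c, c < KS_max hk P -> exists m (w : 'I_m.+1 -> Omega -> R),
    [/\ forall i, \sum_a w i a = 0, \sum_p gram w w p ^+ 2 = 1 &
        c < inner (Xi_op hk P (gram w w)) (gram w w)].
Proof.
rewrite /KS_max; set A := [set _ | _ in _] => A0.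
(* [sup] is 0 on a set without supremum, so a non-zero value certifies that [A] is non-empty and
   bounded above. *)
have hA : has_sup A by apply: contrapT => /sup_out; apply/eqP.
split.
  rewrite lt_neqAle eq_sym A0 /=.
  have [[_ [x [Ex nx] _]] _] := hA.
  have [m [w [w0 nw _]]] := gram_improve Ex nx.
  apply: le_trans (Xi_gram_ge0 w) _; apply: sup_upper_bound => //.
  exists (gram w w) => //; split; first exact: gram_Espace.
  exact/norm2_eq1.
move=> c cA; have [_ [x [Ex nx] <-] cx] := sup_gt hA.1 cA.
have [m [w [w0 nw xw]]] := gram_improve Ex nx.
by exists m, w; split => //; exact: lt_le_trans cx xw.
Qed.

Lemma inner_CauchySchwarz (x y : Omega * Omega -> R) :
  \sum_p x p ^+ 2 = 1 -> inner y x ^+ 2 <= inner y y.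
Proof.
move=> x1; set t := inner y x.
have : 0 <= \sum_p (y p - t * x p) ^+ 2 by apply: sumr_ge0 => p _; exact: sqr_ge0.
have -> : \sum_p (y p - t * x p) ^+ 2 =
    inner y y - 2 * t * inner y x + t ^+ 2 * \sum_p x p ^+ 2.
  rewrite /inner [2 * t * _]mulr_sumr [t ^+ 2 * _]mulr_sumr -sumrB -big_split /=.
  by apply: eq_bigr => p _; ring.
rewrite x1 mulr1 -/t; nra.
Qed.

End kesten_stigum.

(** * The perturbation of the uniform distribution *)

Section perturbed_law.
Context {R : realType} {Omega : finType} (Omega_gt0 : (0 < #|Omega|)%N).
Local Notation q := (#|Omega|%:R : R).
Variables (m : nat) (w : 'I_m.+1 -> Omega -> R) (w0 : forall i, \sum_a w i a = 0).
Variables (t M : R) (t0 : 0 < t) (wM : forall i a, `|w i a| <= M) (tM : t * M <= 1).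
Let q0 := @q_neq0 R _ Omega_gt0.

(** The points (1 + t w_i) / q, followed by the points (1 - t w_i) / q: opposite signs cancel the
    mean deviation and leave the covariance unchanged. *)
Definition perturbed_point (j : nat) : euclidean R Omega := fun a =>
  q^-1 * (1 + (if (j < m.+1)%N then t * w (inord j) a
               else - (t * w (inord (j - m.+1)) a))).

(** [empirical n] has [n.+1] atoms, so [m + m.+1] gives the required 2 (m + 1). *)
Definition perturbed_law : probability (euclidean R Omega) R :=
  empirical (m + m.+1) perturbed_point.

Let ctr_perturbed j a : ctr (perturbed_point j) a =
  if (j < m.+1)%N then t * w (inord j) a else - (t * w (inord (j - m.+1)) a).
Proof. by rewrite /ctr /perturbed_point mulrA divff// mul1r addrC addKr. Qed.

Let near_perturbed j : near_uniform (t * M) (perturbed_point j).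
Proof.
split=> [a|].
  rewrite ctr_perturbed; case: ifP => _; rewrite ?normrN normrM gtr0_norm//;
  by rewrite ler_wpM2l// ltW.
under eq_bigr do rewrite ctr_perturbed.
by case: (j < m.+1)%N; rewrite ?sumrN -mulr_sumr w0 mulr0 ?oppr0.
Qed.

Lemma measurable_near_uniform (e : R) :
  measurable [set rho : euclidean R Omega | near_uniform e rho].
Proof.
have mc a : measurable_fun setT (fun rho : euclidean R Omega => ctr rho a).
  apply: measurable_funB => //; apply: measurable_funM => //; exact: measurable_eval.
have -> : [set rho : euclidean R Omega | near_uniform e rho] =
    (\bigcap_(a in [set: Omega]) ((fun rho => `|ctr rho a|) @^-1` `]-oo, e]%classic)) `&`
    ((fun rho => \sum_a ctr rho a) @^-1` [set 0]).
  apply/seteqP; split => rho.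
    by move=> [h1 h2]; split => // a _ /=; rewrite in_itv /=; exact: h1.
  by move=> [h1 h2]; split => // a; have := h1 a Logic.I; rewrite /= in_itv.
apply: measurableI.
  apply: fin_bigcap_measurable => // a _; rewrite -[_ @^-1` _]setTI.
  have ma : measurable_fun setT (fun rho : euclidean R Omega => `|ctr rho a|).
    by apply: measurableT_comp => //.
  exact: ma.
rewrite -[_ @^-1` _]setTI.
have ms : measurable_fun setT (fun rho : euclidean R Omega => \sum_a ctr rho a).
  exact: measurable_sum.
exact: ms.
Qed.

Lemma perturbed_law_near : {ae perturbed_law, forall rho, near_uniform (t * M) rho}.
Proof.
apply: (@probability1_ae R _ _ perturbed_law [set rho | near_uniform (t * M) rho]).
  exact: measurable_near_uniform.
by apply: empirical1 => i _; exact: near_perturbed.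
Qed.

Let Rintegral_perturbed (f : euclidean R Omega -> R) : measurable_fun setT f ->
  \int[perturbed_law]_rho f rho = (m.+1 + m.+1)%:R^-1 *
   \sum_(i < m.+1) (f (perturbed_point i) + f (perturbed_point (m.+1 + i)%N)).
Proof.
move=> mf; rewrite Rintegral_empirical//; congr (_ * _).
by rewrite -addSn big_split_ord /= -big_split.
Qed.

Lemma perturbed_law_mean a : \int[perturbed_law]_rho rho a = q^-1.
Proof.
rewrite Rintegral_perturbed; last exact: measurable_eval.
rewrite (eq_bigr (fun=> 2 * q^-1)) => [|i _].
  rewrite sumr_const card_ord -[X in _ * X]mulr_natl natrD.
  have : (m.+1%:R : R) != 0 by rewrite pnatr_eq0.
  move: (m.+1%:R : R) => n n0.
  by rewrite (_ : n + n = 2 * n); [field; rewrite n0 q0|ring].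
rewrite /perturbed_point ltn_ord ltnNge leq_addr /= addKn; ring.
Qed.

Lemma perturbed_law_cov u : cov perturbed_law u =
  t ^+ 2 / m.+1%:R * gram w w u.
Proof.
rewrite /cov Rintegral_perturbed; last first.
  by apply: measurable_funM; apply: measurable_funB => //; apply: measurable_funM => //;
     exact: measurable_eval.
rewrite (eq_bigr (fun i => 2 * t ^+ 2 * (w i u.1 * w i u.2))) => [|i _].
  rewrite -mulr_sumr -/(gram w w u) natrD.
  have : (m.+1%:R : R) != 0 by rewrite pnatr_eq0.
  move: (m.+1%:R : R) => n n0.
  by rewrite (_ : n + n = 2 * n); [field|ring].
rewrite !ctr_perturbed ltn_ord ltnNge leq_addr /= addKn inord_val; ring.
Qed.

Lemma perturbed_law_P2star : P2star perturbed_law.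
Proof.
split; last exact: perturbed_law_mean.
apply: empirical1 => j _; have [h1 h2] := near_perturbed j.
have ctrE a : perturbed_point j a = q^-1 * (1 + ctr (perturbed_point j) a).
  by rewrite /ctr; field.
split=> [a|].
  rewrite ctrE mulr_ge0 ?invr_ge0 ?ler0n//.
  by have /ler_normlP[] := h1 a; have := tM; lra.
under eq_bigr do rewrite ctrE.
rewrite -mulr_sumr big_split /= h2 addr0 sumr_const.
by rewrite -[X in X *+ _]/1 mulVf.
Qed.

Lemma perturbed_energy k (hk : (2 <= k)%N)
    (P : probability (euclidean R {ffun 'I_k -> Omega}) R) :
  energy hk P perturbed_law = (t ^+ 2 / m.+1%:R) ^+ 2 *
    inner (Xi_op hk P (gram w w)) (gram w w) /\
  energy2 hk P perturbed_law = (t ^+ 2 / m.+1%:R) ^+ 2 *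
    inner (Xi_op hk P (gram w w)) (Xi_op hk P (gram w w)).
Proof.
rewrite /energy /energy2; set c := t ^+ 2 / m.+1%:R.
have -> : cov perturbed_law = fun u => c * gram w w u.
  by apply/funext => u; rewrite perturbed_law_cov.
have XiZ u : Xi_op hk P (fun u => c * gram w w u) u = c * Xi_op hk P (gram w w) u.
  by rewrite /Xi_op mulr_sumr; apply: eq_bigr => v _; rewrite mulrCA.
split; rewrite /inner mulr_sumr; apply: eq_bigr => u _; rewrite !XiZ; ring.
Qed.

End perturbed_law.

(** * The Bethe functional above the Kesten-Stigum bound *)

Section above_threshold.
Context {R : realType} {Omega : finType} {k : nat} (hk : (2 <= k)%N).
Local Notation q := (#|Omega|%:R : R).
Local Notation weight := (euclidean R {ffun 'I_k -> Omega}).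
Variables (Psi : set weight) (P : probability weight R).
Hypotheses (mPsi : measurable Psi) (wPsi : forall psi, Psi psi -> is_weight psi).
Hypotheses (cPsi : permutation_closed Psi) (PPsi : P Psi = 1%E).
Hypotheses (hSYM : SYM Psi P).

Lemma bethe_gt_above (d : R) : 0 < d -> KS_max hk P != 0 ->
  (d * (k%:R - 1))^-1 < KS_max hk P ->
  exists2 pi, P2star pi &
    ((ln q + d / k%:R * ln (xi P))%:E < bethe hk d P pi)%E.
Proof.
move=> d0 KS0 dKS; have [_ /(_ _ dKS)] := KS_max_witness mPsi wPsi PPsi KS0.
move=> [m [w [w0 nw]]].
set A0 := inner _ _ => cA.
set B0 := inner (Xi_op hk P (gram w w)) (Xi_op hk P (gram w w)).
have Omega_gt0 : (0 < #|Omega|)%N.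
  rewrite lt0n; apply: contra_eq_neq nw => card0; rewrite big1 ?(eq_sym 0) ?oner_eq0//.
  by move=> -[a]; have := fintype0 a card0.
have q_pos := @q_gt0 R _ Omega_gt0.
have k1 : 1 <= (k%:R : R) - 1 by rewrite lerBrDr (_ : 1 + 1 = 2%:R)// ler_nat.
have k0 : 0 < (k%:R : R) by lra.
have dk : 0 < d * (k%:R - 1) by rewrite mulr_gt0//; lra.
have A0_gt0 : 0 < A0 by apply: lt_trans cA; rewrite invr_gt0.
(* The Gram matrix has norm 1, so Cauchy-Schwarz gives [A0 ^+ 2 <= B0]; combined with
   [1 < d * (k%:R - 1) * A0] this is the instability. *)
have AB : A0 < d * (k%:R - 1) * B0.
  have h1 : 1 < d * (k%:R - 1) * A0 by move: cA; rewrite -ltr_pdivrMl// mulr1.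
  have h2 : A0 ^+ 2 <= B0 by exact: inner_CauchySchwarz.
  apply: (@lt_le_trans _ _ (d * (k%:R - 1) * A0 * A0)).
    by rewrite -[X in X < _]mul1r ltr_pM2r.
  by rewrite -mulrA -expr2 ler_pM2l.
(* Up to a common factor, i al + i (i - 1) be is the second moment of the star's quadratic part at
   degree i, [Z] is its Poisson mean, and [target] is the edge contribution to be beaten. *)
pose al := (k%:R - 1) * (k%:R - 2) * A0; pose be := (k%:R - 1) ^+ 2 * B0.
have al0 : 0 <= al by rewrite /al !mulr_ge0//; lra.
have B0_ge0 : 0 <= B0 by apply: sumr_ge0 => p _; rewrite -expr2 sqr_ge0.
have be0 : 0 <= be by rewrite /be mulr_ge0// sqr_ge0.
pose target := d * (k%:R - 1) ^+ 2 * A0.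
pose Z := al * d + be * d ^+ 2.
have target0 : 0 <= target.
  by apply: mulr_ge0; [apply: mulr_ge0; [exact: ltW|exact: sqr_ge0]|exact: ltW].
have ZT : target < Z.
  rewrite -subr_gt0 (_ : Z - target = d * (k%:R - 1) * (d * (k%:R - 1) * B0 - A0)).
    by rewrite mulr_gt0// subr_gt0.
  by rewrite /Z /target /al /be; ring.
have Z0 : 0 < Z by exact: le_lt_trans ZT.
(* As [target / Z < 1], enough Poisson mass below the cutoff keeps the truncated mean [Q] above
   [target]. *)
have [n hn] : exists n, target / Z < \sum_(i < n) poisson_pmf d i.
  by apply: poisson_pmf_sum_gt => //; rewrite ltr_pdivrMr// mul1r.
pose Q := \sum_(i < n.+2) poisson_pmf d i * (i%:R * al + i%:R * (i%:R - 1) * be).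
have TQ : target < Q.
  apply: lt_le_trans (poisson_factorial_moments d0 n al0 be0).
  by move: hn; rewrite ltr_pdivrMr// mulrC.
pose D := d * (k%:R - 1) / k%:R.
have D0 : 0 <= D by rewrite /D divr_ge0 ?ltW.
pose Cs i := entropy_const (@star_const R k i).
pose Ce := entropy_const (@edge_const R k).
have ec0 := @edge_const_ge0 R k.
have sc0 i : 0 <= @star_const R k i by exact: jet_const_ge0.
have Cs0 i : 0 <= Cs i by exact: entropy_const_ge0.
have Ce0 : 0 <= Ce by exact: entropy_const_ge0.
(* The total coefficient of e^5 in the error; it is finite because only degrees below the cutoff are
   expanded. *)
pose K := \sum_(i < n.+2) poisson_pmf d i * Cs i + D * Ce.
have K0 : 0 <= K.
  apply: addr_ge0; last exact: mulr_ge0.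
  by apply: sumr_ge0 => i _; apply: mulr_ge0; [exact: poisson_pmf_ge0|exact: Cs0].
(* Dominates the constants of all smallness conditions on [e]; the summand 1 ensures [e <= 1]. *)
pose Ct : R := 1 + 4 * @edge_const R k + \sum_(i < n.+2) 4 * @star_const R k i.
have sum0 : 0 <= \sum_(i < n.+2) 4 * @star_const R k i.
  by apply: sumr_ge0 => i _; rewrite mulr_ge0.
have Ct1 : 1 <= Ct by rewrite /Ct -addrA lerDl addr_ge0// mulr_ge0.
pose M : R := 1 + \sum_i \sum_a `|w i a|.
have M1 : 1 <= M.
  by rewrite lerDl; apply: sumr_ge0 => i _; apply: sumr_ge0.
have wM i a : `|w i a| <= M.
  rewrite /M (bigD1 i)//= (bigD1 a)//=.
  have : 0 <= \sum_(j | j != i) \sum_b `|w j b|.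
    by apply: sumr_ge0 => j _; apply: sumr_ge0.
  have : 0 <= \sum_(b | b != a) `|w i b| by apply: sumr_ge0.
  lra.
pose dl := 4^-1 * q ^- 2 * (Q - target) / m.+1%:R ^+ 2.
have m0 : 0 < (m.+1%:R : R) by rewrite ltr0n.
have dl0 : 0 < dl.
  rewrite /dl divr_gt0 ?exprn_gt0// mulr_gt0 ?subr_gt0// mulr_gt0 ?invr_gt0//.
  by rewrite exprn_gt0.
(* The net gain will be t^4 (dl - t M^5 K), with e = t M. The reciprocal of a sum of two positive
   terms secures both t M Ct <= 1 and t M^5 K < dl. *)
pose t := (M * Ct + (M ^+ 5 * K + 1) / dl)^-1.
have MC0 : 0 < M * Ct by rewrite mulr_gt0//; lra.
have MK0 : 0 <= M ^+ 5 * K by rewrite mulr_ge0// exprn_ge0//; lra.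
have MK1 : 0 < (M ^+ 5 * K + 1) / dl by rewrite divr_gt0//; lra.
have t0 : 0 < t by rewrite invr_gt0 addr_gt0.
have tden : t * (M * Ct + (M ^+ 5 * K + 1) / dl) = 1.
  by rewrite mulVf// gt_eqF// addr_gt0.
have tMC : t * M * Ct <= 1.
  by rewrite -[leRHS]tden -mulrA; apply: ler_wpM2l; [exact: ltW|rewrite lerDl ltW].
have tMK : t * (M ^+ 5 * K) < dl.
  have : t * ((M ^+ 5 * K + 1) / dl) <= 1.
    by rewrite -[leRHS]tden; apply: ler_wpM2l; [exact: ltW|rewrite lerDr ltW].
  rewrite mulrA ler_pdivrMr// mul1r mulrDr mulr1; lra.
pose e := t * M.
have e0 : 0 <= e by rewrite mulr_ge0 ?ltW//; lra.
have e1 : e <= 1 by apply: le_trans tMC; rewrite ler_peMr.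
have small c : 0 <= c -> 4 * c <= Ct -> 4 * c * e ^+ 2 <= 1.
  move=> c0 cC; apply: (@le_trans _ _ (4 * c * e)).
    by rewrite ler_wpM2l ?mulr_ge0// expr2 ler_piMl.
  by apply: le_trans tMC; rewrite -/e mulrC ler_wpM2l.
have he : 4 * @edge_const R k * e ^+ 2 <= 1.
  by apply: small => //; rewrite /Ct; lra.
have hs i : (i < n.+2)%N -> 4 * @star_const R k i * e ^+ 2 <= 1.
  move=> i_n; apply: small => //; rewrite /Ct (bigD1 (Ordinal i_n))//=.
  have : 0 <= \sum_(j < n.+2 | j != Ordinal i_n) 4 * @star_const R k j.
    by apply: sumr_ge0 => j _; rewrite mulr_ge0.
  by move: ec0; lra.
pose pi := perturbed_law w t.
have piP : P2star pi by exact: (perturbed_law_P2star Omega_gt0 w0 t0 wM e1).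
exists pi => //.
have [EA EB] := perturbed_energy Omega_gt0 w t hk P.
pose s2 := t ^+ 2 / m.+1%:R.
rewrite -/pi -/A0 -/B0 -/s2 in EA EB.
have e01 : 0 <= e <= 1 by rewrite e0 e1.
pose c0 := ln q - D * (ln (xi P) +
   4^-1 * (k%:R * (k%:R - 1) * (q ^- 2 * (s2 ^+ 2 * A0))) + Ce * e ^+ 5).
pose h (i : nat) := 4^-1 * (q ^- 2 * (i%:R * (k%:R - 1) * (k%:R - 2) * (s2 ^+ 2 * A0) +
   i%:R * (i%:R - 1) * (k%:R - 1) ^+ 2 * (s2 ^+ 2 * B0))) - Cs i * e ^+ 5.
apply: lt_le_trans (poisson_integral_ge d0 (c0 := c0) (c1 := ln (xi P)) (h := h)
  (n := n.+2) _); last first.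
  move=> i.
  have := @bethe_inner_ge _ _ _ hk _ _ mPsi wPsi cPsi PPsi hSYM Omega_gt0 pi e e01
    (perturbed_law_near Omega_gt0 w0 t0 wM) (perturbed_law_mean Omega_gt0 w t)
    i d (i < n.+2)%N (ltW d0) he (@hs i).
  apply: le_trans; rewrite lee_fin EA EB -/D -/Ce -/(Cs i) /c0 /h.
  rewrite le_eqVlt; apply/orP; left; apply/eqP.
  by case: (i < n.+2)%N; rewrite ?mul1r ?mul0r; ring.
rewrite lte_fin.
have sumh : \sum_(i < n.+2) poisson_pmf d i * h i =
    4^-1 * q ^- 2 * s2 ^+ 2 * Q - e ^+ 5 * \sum_(i < n.+2) poisson_pmf d i * Cs i.
  rewrite /Q !mulr_sumr -sumrB; apply: eq_bigr => i _; rewrite /h /al /be; ring.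
rewrite sumh -subr_gt0.
have -> : c0 + d * ln (xi P) + (4^-1 * q ^- 2 * s2 ^+ 2 * Q -
     e ^+ 5 * \sum_(i < n.+2) poisson_pmf d i * Cs i) -
    (ln q + d / k%:R * ln (xi P)) = t ^+ 4 * (dl - t * (M ^+ 5 * K)).
  rewrite /c0 /D /dl /target /K /s2 /e /D.
  move: (\sum_(i < n.+2) _) (ln (xi P)) (ln q) => sC lx lq.
  have [qn kn mn] : [/\ q != 0, (k%:R : R) != 0 & (m.+1%:R : R) != 0].
    by rewrite !gt_eqF.
  by move: q (k%:R : R) (m.+1%:R : R) qn kn mn => x y z x0 y0 z0; field; rewrite x0 y0 z0.
by rewrite mulr_gt0 ?exprn_gt0// subr_gt0.
Qed.

End above_threshold.

Theorem theorem2p3 (R : realType) (Omega : finType) (k : nat)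
    (hk : (2 <= k)%N)
    (Psi : set (euclidean R {ffun 'I_k -> Omega}))
    (P : probability (euclidean R {ffun 'I_k -> Omega}) R)
    (mPsi : measurable Psi)
    (wPsi : forall psi, Psi psi -> is_weight psi)
    (cPsi : permutation_closed Psi)
    (PPsi : P Psi = 1%E)
    (hP : standing_assumption P)
    (hSYM : SYM Psi P)
    (hBAL : BAL P) :
  (dcond hk P <= dKS hk P)%E.
Proof.
rewrite /dKS; case: ifPn => [_|KS0]; first by rewrite leey.
have [KS_gt0 _] := KS_max_witness mPsi wPsi PPsi KS0.
have k1 : 0 < (k%:R : R) - 1 by rewrite subr_gt0 ltr1n.
have kKS : 0 < (k%:R - 1) * KS_max hk P by rewrite mulr_gt0.
(* Every [d] strictly above the Kesten-Stigum bound lies in the set defining [dcond], so the infimum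
   is at most that bound plus any positive [e]. *)
apply/lee_addgt0Pr => e e0; set d := ((k%:R - 1) * KS_max hk P)^-1 + e.
have d0 : 0 < d by rewrite addr_gt0// invr_gt0.
apply: ereal_inf_lbound; exists d => //; split => //.
have dk : 0 < d * (k%:R - 1) by rewrite mulr_gt0.
have above : (d * (k%:R - 1))^-1 < KS_max hk P.
  rewrite -(ltr_pM2l dk) divff ?gt_eqF// -mulrA -ltr_pdivrMr// mul1r.
  by rewrite /d ltrDl.
have [pi piP hpi] := bethe_gt_above mPsi wPsi cPsi PPsi hSYM d0 KS0 above.
by apply: lt_le_trans hpi _; apply: ereal_sup_ubound; exists pi.
Qed.
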